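(* Let $d\ge1$, $0\le\mathfrak a<\mathfrak b$, $\mathfrak c\ge0$, $\beta\ge0$, $\gamma>-1$. For $n\ge0$ let $\operatorname{proj}^{\circ,\mathsf E}_n$ be the orthogonal projection of $L^2(\mathbf W^{\beta,\gamma}_{\mathfrak a,\mathfrak b,\mathfrak c},\Lambda^{d+1}_{\mathfrak a,\mathfrak b,\mathfrak c})$ onto the restrictions to $\Lambda^{d+1}_{\mathfrak a,\mathfrak b,\mathfrak c}$ of $\mathcal V^{\mathsf E}_n(\mathbf W^{\beta,\gamma}_{\mathfrak a,\mathfrak b,\mathfrak c},\mathbb X^{d+1}_{\mathfrak a,\mathfrak b,\mathfrak c})$. If $f\in L^2(\mathbf W^{\beta,\gamma}_{\mathfrak a,\mathfrak b,\mathfrak c},\Lambda^{d+1}_{\mathfrak a,\mathfrak b,\mathfrak c})$, then $f=\sum_{n=0}^\infty\operatorname{proj}^{\circ,\mathsf E}_n f$ in $L^2(\mathbf W^{\beta,\gamma}_{\mathfrak a,\mathfrak b,\mathfrak c},\Lambda^{d+1}_{\mathfrak a,\mathfrak b,\mathfrak c})$.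
   Context: $\mathbb X^{d+1}_{\mathfrak a,\mathfrak b,\mathfrak c}=\{(\mathbf x,t)\in\mathbb R^d\times\mathbb R:\|\mathbf x\|\le1,\ \mathfrak a+(\mathfrak c-\mathfrak a)\|\mathbf x\|^2\le t^2\le\mathfrak b+(\mathfrak c-\mathfrak b)\|\mathbf x\|^2\}$, $\Lambda^{d+1}_{\mathfrak a,\mathfrak b,\mathfrak c}=\{(\mathbf x,t)\in\mathbb X^{d+1}_{\mathfrak a,\mathfrak b,\mathfrak c}:t\ge0\}$, weight $\mathbf W^{\beta,\gamma}_{\mathfrak a,\mathfrak b,\mathfrak c}(\mathbf x,t)=|t|\Big(\frac{-\mathfrak a+(\mathfrak a-\mathfrak c)\|\mathbf x\|^2+t^2}{\mathfrak b-\mathfrak a}\Big)^{\beta-\frac12}\Big(\frac{\mathfrak b-(\mathfrak b-\mathfrak c)\|\mathbf x\|^2-t^2}{\mathfrak b-\mathfrak a}\Big)^\gamma$. $\mathcal V^{\mathsf E}_n(\mathbf W,\mathbb X^{d+1}_{\mathfrak a,\mathfrak b,\mathfrak c})$ is the space of polynomials of degree $n$, even in $t$, orthogonal in $L^2(\mathbf W,\mathbb X^{d+1}_{\mathfrak a,\mathfrak b,\mathfrak c})$ to all polynomials of lower degree. *)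

(* Defs.v *)
From HB Require Import structures.
From mathcomp Require Import all_boot all_order all_algebra.
From mathcomp Require Import all_classical all_reals all_analysis.

Set Implicit Arguments.
Unset Strict Implicit.
Unset Printing Implicit Defensive.

Import Order.TTheory GRing.Theory Num.Theory.
Import numFieldNormedType.Exports.

Local Open Scope classical_set_scope.
Local Open Scope ring_scope.

(* Points of R^{d+1} are pairs (x, t) with x : d.-tuple R and t : R.
   d.-tuple R carries the product (Borel) sigma-algebra of the library. *)
Definition pt (R : realType) (d : nat) := (d.-tuple R * R)%type.

Definition norm2 (R : realType) (d : nat) (x : d.-tuple R) : R :=
  \sum_(i < d) (tnth x i) ^+ 2.

(* Lebesgue integral over R^n, as the iterated integral of one-dimensional
   Lebesgue integrals (equal to the integral w.r.t. n-dimensional Lebesgue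
   measure for nonnegative measurable or integrable integrands, by
   Fubini--Tonelli). *)
Fixpoint tint (R : realType) (n : nat) : (n.-tuple R -> \bar R) -> \bar R :=
  match n return (n.-tuple R -> \bar R) -> \bar R with
  | 0 => fun F => F [tuple]
  | m.+1 => fun F =>
      (\int[@lebesgue_measure R]_(y in setT) tint (fun v => F (cons_tuple y v)))%E
  end.

Definition integ (R : realType) (d : nat) (D : set (pt R d)) (g : pt R d -> R)
  : \bar R :=
  tint (fun x => (\int[@lebesgue_measure R]_(t in [set t | D (x, t)])
                    (g (x, t))%:E)%E).

Definition domX (R : realType) (d : nat) (a b c : R) : set (pt R d) :=
  [set p | norm2 p.1 <= 1 /\
           a + (c - a) * norm2 p.1 <= p.2 ^+ 2 /\
           p.2 ^+ 2 <= b + (c - b) * norm2 p.1].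

Definition domL (R : realType) (d : nat) (a b c : R) : set (pt R d) :=
  [set p | domX a b c p /\ 0 <= p.2].

Definition weightW (R : realType) (d : nat) (a b c beta gamma : R)
  (p : pt R d) : R :=
  `|p.2| *
  powR ((- a + (a - c) * norm2 p.1 + p.2 ^+ 2) / (b - a)) (beta - 2^-1) *
  powR ((b - (b - c) * norm2 p.1 - p.2 ^+ 2) / (b - a)) gamma.

Definition ipW (R : realType) (d : nat) (a b c beta gamma : R)
  (D : set (pt R d)) (g h : pt R d -> R) : \bar R :=
  integ D (fun p => g p * h p * weightW a b c beta gamma p).

Definition inL2 (R : realType) (d : nat) (a b c beta gamma : R)
  (f : pt R d -> R) : Prop :=
  measurable_fun setT f /\
  (ipW a b c beta gamma (domL a b c) f f < +oo)%E.

Definition is_poly (R : realType) (d n : nat) (p : pt R d -> R) : Prop :=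
  exists cf : {ffun 'I_d -> 'I_n.+1} -> 'I_n.+1 -> R,
    (forall (al : {ffun 'I_d -> 'I_n.+1}) (k : 'I_n.+1),
       (n < \sum_(i < d) (al i : nat) + k)%N -> cf al k = 0) /\
    forall x t, p (x, t) =
      \sum_(al : {ffun 'I_d -> 'I_n.+1}) \sum_(k < n.+1)
        cf al k * (\prod_(i < d) tnth x i ^+ al i) * t ^+ k.

Definition even_t (R : realType) (d : nat) (p : pt R d -> R) : Prop :=
  forall x t, p (x, - t) = p (x, t).

Definition inVE (R : realType) (d : nat) (a b c beta gamma : R) (n : nat)
  (p : pt R d -> R) : Prop :=
  is_poly n p /\ even_t p /\
  forall m q, (m < n)%N -> is_poly m q ->
    ipW a b c beta gamma (domX a b c) p q = 0%E.

Definition is_projE (R : realType) (d : nat) (a b c beta gamma : R) (n : nat)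
  (f P : pt R d -> R) : Prop :=
  inVE a b c beta gamma n P /\
  forall q, inVE a b c beta gamma n q ->
    ipW a b c beta gamma (domL a b c) (f \- P) q = 0%E.

(* Main.v *)
Require Import Defs.
From HB Require Import structures.
From mathcomp Require Import all_boot all_order all_algebra.
From mathcomp Require Import all_classical all_reals all_analysis.
From mathcomp Require Import measurable_realfun ring lra.

Set Implicit Arguments.
Unset Strict Implicit.
Unset Printing Implicit Defensive.

Import Order.TTheory GRing.Theory Num.Theory.
Import numFieldNormedType.Exports.

Local Open Scope classical_set_scope.
Local Open Scope ring_scope.

(* Since P_0, ..., P_(N-1) are orthogonal projections onto mutually orthogonal
   spaces whose sum is the space of even polynomials of degree < N, the partial
   sum is the best L^2 approximation of f among these polynomials; so it
   suffices that polynomials even in t are dense in L^2(W, Lambda).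

   Density, without Weierstrass: on the bounded set Lambda the bounded L^2 limits
   of even polynomials form an algebra closed under bounded pointwise limits.
   Iterating the polynomial 3 u^2 - 2 u^3, which pushes [0, 1/2) to 0 and
   (1/2, 1] to 1, it contains the indicators of the superlevel sets of x_i and
   t^2, hence those of all Borel sets (t >= 0 on Lambda).

   All this needs W to be integrable.  With u = (t^2 - A) / (b - a) and
   v = (B - t^2) / (b - a), where A, B are the extreme values of t^2 on the fibre
   over x, one has u + v = rho = 1 - |x|^2 and W = t u^(beta - 1/2) v^gamma; the
   integral over the fibre is O(rho^(-1/2)), and the arcsine integral in one
   coordinate of x, available as d >= 1, makes this integrable over the ball.

   Orthogonality is imposed on the domain X symmetric in t; as W is even in t,
   for a function even in t it amounts to orthogonality on Lambda to the even
   polynomials of lower degree. *)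

(** * Iterated Lebesgue integrals *)

Section iterated_integral.
Context {R : realType}.
Local Notation leb := (@lebesgue_measure R).

(** The integral is the difference of the integrals of the positive and negative parts, and
    Tonelli's theorem makes each of these measurable in [x]. *)
Lemma measurable_integral_section d1 d2 (T1 : measurableType d1)
    (T2 : measurableType d2) (m2 : {sigma_finite_measure set T2 -> \bar R})
    (F : T1 * T2 -> \bar R) :
  measurable_fun setT F ->
  measurable_fun setT (fun x => \int[m2]_y F (x, y))%E.
Proof.
move=> mF.
rewrite (_ : (fun _ => _) = (fun x => \int[m2]_y F^\+ (x, y) -
    \int[m2]_y F^\- (x, y)))%E; last first.
  apply/funext => x; rewrite [LHS]integralE.
  under eq_integral do rewrite funepos_comp/=.
  by under [X in (_ - X = _)%E]eq_integral do rewrite funeneg_comp/=.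
apply: emeasurable_funB.
- by apply: (measurable_fun_fubini_tonelli_F (m2 := m2) F^\+%E) => //;
    exact: measurable_funepos.
- by apply: (measurable_fun_fubini_tonelli_F (m2 := m2) F^\-%E) => //;
    exact: measurable_funeneg.
Qed.

(** Both exhaustions can be taken nondecreasing, so products of sets of equal index already cover: a
    point of [F i] times [G j] lies in the product of index [maxn i j]. *)
Lemma product_sigma_finite d1 d2 (T1 : measurableType d1)
    (T2 : measurableType d2) (m1 : {sigma_finite_measure set T1 -> \bar R})
    (m2 : {sigma_finite_measure set T2 -> \bar R}) :
  sigma_finite setT (m1 \x m2)%E.
Proof.
have /sigma_finiteP[F [FT ndF finF]] := sigma_finiteT m1.
have /sigma_finiteP[G [GT ndG finG]] := sigma_finiteT m2.
exists (fun n => F n `*` G n) => [|k].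
  apply/esym; rewrite -subTset => -[x y] _.
  have [i _ Fx] : (\bigcup_i F i) x by rewrite -FT.
  have [j _ Gy] : (\bigcup_i G i) y by rewrite -GT.
  exists (maxn i j) => //; split => /=.
    by move: Fx; apply/subsetPset/ndF/leq_maxl.
  by move: Gy; apply/subsetPset/ndG/leq_maxr.
have [mF fF] := finF k; have [mG fG] := finG k.
split; first exact: measurableX.
by rewrite product_measure1E// lte_mul_pinfty// ge0_fin_numE.
Qed.

Lemma measurable_cons_tuple d1 (Z : measurableType d1) n (y : Z -> R)
    (v : Z -> n.-tuple R) :
  measurable_fun setT y -> measurable_fun setT v ->
  measurable_fun setT (fun z => cons_tuple (y z) (v z)).
Proof. exact: measurable_cons. Qed.

(** The induction runs over all parameter spaces: the outermost integration variable joins the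
    parameter, [Z] becoming [Z * R]. *)
Lemma measurable_tint n d1 (Z : measurableType d1)
    (F : Z * n.-tuple R -> \bar R) :
  measurable_fun setT F ->
  measurable_fun setT (fun z => tint (fun v => F (z, v))).
Proof.
elim: n d1 Z F => [|n IH] d1 Z F mF /=.
  by apply: (measurableT_comp mF); exact: measurable_fun_pair.
apply: (@measurable_integral_section _ _ _ _ leb
  (fun zy : Z * R => tint (fun v => F (zy.1, cons_tuple zy.2 v)))).
apply: (IH _ (Z * R)%type
  (fun zv : (Z * R) * n.-tuple R => F (zv.1.1, cons_tuple zv.1.2 zv.2))).
apply: (measurableT_comp mF); apply: measurable_fun_pair => /=.
  exact: measurableT_comp.
apply: measurable_cons_tuple => //.
exact: (measurableT_comp measurable_snd).
Qed.

Let cns n (z : measurableTypeR R * n.-tuple R) : n.+1.-tuple R := cons_tuple z.1 z.2.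

Let measurable_cns n : measurable_fun setT (@cns n).
Proof. exact: measurable_cons_tuple. Qed.

(** Adds one coordinate in front, as the image of a product with one-dimensional Lebesgue measure.
    Iterated, this yields Lebesgue measure on tuples, with the coordinates in the order used by
    [tint]. *)
Definition cons_measure n
    (m : {sigma_finite_measure set (n.-tuple R) -> \bar R}) :=
  pushforward (leb \x m)%E (@cns n).

Section cons_measure.
Variables (n : nat) (m : {sigma_finite_measure set (n.-tuple R) -> \bar R}).

HB.instance Definition _ := Measure.copy (cons_measure m)
  (measure_function_pushforward__canonical__measure_function_Measure
    (leb \x m)%E (@measurable_cns n)).

Let sigma_finite_cons_measure : sigma_finite setT (cons_measure m).
Proof.
have [F UF mF] : sigma_finite setT (leb \x m)%E by exact: product_sigma_finite.
(* [i] inverts [cns], so the preimages under [i] of an exhaustion of the product exhaust the tuples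
   and have the same measures. *)
pose i := fun v : n.+1.-tuple R => (tnth v ord0, [tuple of behead v]).
have mi : measurable_fun setT i.
  by apply: measurable_fun_pair; [exact: measurable_tnth|exact: measurable_behead].
have cK z : i (cns z) = z.
  by case: z => y v; congr pair; apply/val_inj.
exists (fun k => i @^-1` (F k)) => [|k].
  by rewrite -preimage_bigcup -UF preimage_setT.
split; first by rewrite -[X in measurable X]setTI; apply: mi => //; exact: (mF k).1.
rewrite /cons_measure /pushforward -comp_preimage (_ : i \o _ = id).
  exact: (mF k).2.
exact/funext.
Qed.

HB.instance Definition _ := Measure_isSigmaFinite.Build _ _ _ (cons_measure m)
  sigma_finite_cons_measure.
End cons_measure.

Fixpoint tuple_lebesgue n : {sigma_finite_measure set (n.-tuple R) -> \bar R} :=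
  match n return {sigma_finite_measure set (n.-tuple R) -> \bar R} with
  | 0 => [the {sigma_finite_measure set (0.-tuple R) -> \bar R} of dirac [tuple]]
  | m.+1 => [the {sigma_finite_measure set (m.+1.-tuple R) -> \bar R} of
              cons_measure (tuple_lebesgue m)]
  end.

Lemma tint_ge0E n (F : n.-tuple R -> \bar R) :
  measurable_fun setT F -> (forall v, 0 <= F v)%E ->
  tint F = (\int[tuple_lebesgue n]_v F v)%E.
Proof.
elim: n F => [|n IH] F mF F0 /=.
  by rewrite integral_dirac// diracT mul1e.
have -> := ge0_integral_pushforward (@measurable_cns n)
  (leb \x tuple_lebesgue n)%E measurableT mF (fun y _ => F0 y).
rewrite preimage_setT.
have mFc := measurableT_comp mF (@measurable_cns n).
rewrite fubini_tonelli1//; last by move=> x; exact: F0.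
apply: eq_integral => y _; rewrite IH//.
by apply: (measurableT_comp mF); exact: measurable_cons_tuple.
Qed.

Lemma tint_integrableE n (F : n.-tuple R -> \bar R) :
  (tuple_lebesgue n).-integrable setT F ->
  tint F = (\int[tuple_lebesgue n]_v F v)%E.
Proof.
elim: n F => [|n IH] F iF /=.
  by rewrite integral_dirac ?diracT ?mul1e//; exact: measurable_int iF.
have mF := measurable_int _ iF.
have mFc := measurableT_comp mF (@measurable_cns n).
have iFc : (leb \x tuple_lebesgue n)%E.-integrable setT (F \o @cns n).
  apply/integrableP; split => //.
  have /integrableP[_] := iF.
  rewrite -(ge0_integral_pushforward (@measurable_cns n)
    (leb \x tuple_lebesgue n)%E measurableT (f := abse \o F))//.
    exact: measurableT_comp.
  by move=> y _; exact: abse_ge0.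
have := integral_pushforward (@measurable_cns n)
  (mu := (leb \x tuple_lebesgue n)%E) (D := setT) mF.
rewrite preimage_setT => /(_ iFc measurableT) pushE.
rewrite [RHS](_ : _ = \int[leb \x tuple_lebesgue n]_z (F \o @cns n) z)%E;
  last exact: pushE.
rewrite -integral12_prod_meas1//.
(* Sections of an integrable function are integrable only for almost every [y], so the induction
   hypothesis identifies the inner integrals almost everywhere. *)
apply: ae_eq_integral => //.
- apply: (@measurable_tint n _ R (fun z : R * n.-tuple R => F (@cns n z))).
  exact: mFc.
- exact: (measurable_fubini_F iFc).
- by have := ae_integrable1 iFc; apply: filterS => y iy _; apply: IH; exact: iy.
Qed.

End iterated_integral.

(** * Polynomial approximation of a step function *)

Section smoothstep.
Context {R : realType}.
Implicit Types u : R.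

(* A polynomial self-map of [0, 1] whose iterates converge to the step function
   at 1/2; this replaces the Weierstrass approximation theorem. *)
Definition smoothstep u : R := u ^+ 2 * (3 - 2 * u).

Lemma smoothstep_sym u : smoothstep (1 - u) = 1 - smoothstep u.
Proof. by rewrite /smoothstep; ring. Qed.

Lemma iter_smoothstep_sym n u :
  iter n smoothstep (1 - u) = 1 - iter n smoothstep u.
Proof. by elim: n => //= n ->; rewrite smoothstep_sym. Qed.

Lemma smoothstep_itv u : 0 <= u <= 1 -> 0 <= smoothstep u <= 1.
Proof.
move=> /andP[u0 u1]; apply/andP; split.
  by rewrite mulr_ge0 ?sqr_ge0//; lra.
rewrite -subr_ge0 -smoothstep_sym mulr_ge0 ?sqr_ge0//; lra.
Qed.

Lemma iter_smoothstep_itv n u : 0 <= u <= 1 -> 0 <= iter n smoothstep u <= 1.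
Proof. by move=> u01; elim: n => //= n; exact: smoothstep_itv. Qed.

(** For 0 <= v <= u < 1/2, [smoothstep v] is v (3 - 2 v) v <= r v with r = u (3 - 2 u) < 1, so the
    iterates decay geometrically. *)
Lemma cvg_iter_smoothstep0 u : 0 <= u < 2^-1 ->
  iter n smoothstep u @[n --> \oo] --> (0 : R).
Proof.
move=> /andP[u0 u1].
pose r := u * (3 - 2 * u).
have r0 : 0 <= r by rewrite mulr_ge0//; lra.
have r1 : r < 1.
  by rewrite -subr_gt0 (_ : _ - _ = (1 - u) * (1 - 2 * u)) ?mulr_gt0 /r//;
    [lra|lra|ring].
have bnd n : 0 <= iter n smoothstep u <= r ^+ n * u.
  elim: n => [|n /andP[v0 vr]]; first by rewrite /= expr0 mul1r u0 lexx.
  set v := iter n smoothstep u in v0 vr *.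
  have vu : v <= u by rewrite (le_trans vr)// ler_piMl// exprn_ile1// ltW.
  rewrite iterS -/v; have /andP[-> _]/= : 0 <= smoothstep v <= 1.
    by apply: smoothstep_itv; lra.
  rewrite exprS -mulrA (@le_trans _ _ (r * v))//; last exact: ler_wpM2l.
  rewrite /smoothstep expr2 (_ : v * v * _ = v * (3 - 2 * v) * v); last by ring.
  rewrite ler_wpM2r// /r -subr_ge0.
  rewrite (_ : _ - _ = (u - v) * (3 - 2 * u - 2 * v)); last by ring.
  by rewrite mulr_ge0//; lra.
apply: (squeeze_cvgr (f := fun=> 0) (h := fun n => r ^+ n * u)).
- by apply: nearW => n; exact: bnd.
- exact: cvg_cst.
- rewrite -[X in _ --> X](mul0r u); apply: cvgMl; apply: cvg_expr.
  by rewrite ger0_norm.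
Qed.

Lemma cvg_iter_smoothstep1 u : 2^-1 < u <= 1 ->
  iter n smoothstep u @[n --> \oo] --> (1 : R).
Proof.
move=> /andP[u0 u1].
rewrite (_ : (fun n => _) = (fun n => 1 - iter n smoothstep (1 - u))); last first.
  by apply/funext => n; rewrite iter_smoothstep_sym opprB addrC subrK.
rewrite -[X in _ --> X]subr0; apply: cvgB; first exact: cvg_cst.
by apply: cvg_iter_smoothstep0; lra.
Qed.

Lemma iter_smoothstep_half n : iter n smoothstep 2^-1 = 2^-1 :> R.
Proof. by elim: n => //= n ->; rewrite /smoothstep; field. Qed.

(** The iterates of [smoothstep] stay at 1/2 when started there. The polynomial 2 v^2 - v keeps 0
    and 1 and sends 1/2 to 0, so the limit is the indicator of u > 1/2 on all of [0, 1]. *)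
Definition smoothstep2 n u := let v := iter n smoothstep u in 2 * v ^+ 2 - v.

Lemma smoothstep2_bound n u : 0 <= u <= 1 -> `|smoothstep2 n u| <= 1.
Proof.
move=> /(iter_smoothstep_itv n); rewrite /smoothstep2.
by set v := iter _ _ _ => /andP[v0 v1]; rewrite ler_norml; apply/andP; split; nra.
Qed.

Lemma cvg_smoothstep2 u : 0 <= u <= 1 ->
  smoothstep2 n u @[n --> \oo] --> ((2^-1 < u)%R%:R : R).
Proof.
move=> /andP[u0 u1].
have H (l : R) : iter n smoothstep u @[n --> \oo] --> l ->
    smoothstep2 n u @[n --> \oo] --> 2 * l ^+ 2 - l.
  move=> ul; apply: cvgB => //; apply: cvgM; first exact: cvg_cst.
  by rewrite expr2; under eq_fun do rewrite expr2; exact: cvgM.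
have [ul|ul|ul] := ltgtP 2^-1 u.
- by rewrite [X in _ --> X](_ : _ = 2 * 1 ^+ 2 - 1); [apply/H/cvg_iter_smoothstep1; rewrite ul|rewrite /=; ring].
- by rewrite [X in _ --> X](_ : _ = 2 * 0 ^+ 2 - 0); [apply/H/cvg_iter_smoothstep0; rewrite ul u0|rewrite /=; ring].
- rewrite [X in _ --> X](_ : _ = 2 * 2^-1 ^+ 2 - 2^-1); last by rewrite /=; field.
  by apply: H; rewrite -ul; under eq_fun do rewrite iter_smoothstep_half; exact: cvg_cst.
Qed.

End smoothstep.

(** * Density in a weighted L2 space *)

Lemma cvge0_near_lt {R : realType} (u : (\bar R)^nat) (e : R) : 0 < e ->
  u n @[n --> \oo] --> 0%E -> \forall n \near \oo, (u n < e%:E)%E.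
Proof.
move=> e0 u0; apply: (u0 [set y | y < e%:E]%E).
by apply: open_nbhs_nbhs; split; [exact: open_ereal_lt_ereal|rewrite /= lte_fin].
Qed.

Section weighted_density.
Context d (T : measurableType d) {R : realType}.
Context (m : {measure set T -> \bar R}) (D : set T) (w : T -> R).
Hypothesis mw : measurable_fun setT w.
Hypothesis w0 : forall z, 0 <= w z.
Hypothesis wD : forall z, ~ D z -> w z = 0.
Hypothesis iw : m.-integrable setT (EFin \o w).
Implicit Types g h : T -> R.

Definition wsq h : \bar R := (\int[m]_z (h z ^+ 2 * w z)%:E)%E.

Let measurable_wsq h : measurable_fun setT h ->
  measurable_fun setT (fun z => (h z ^+ 2 * w z)%:E).
Proof.
by move=> mh; apply/measurable_EFinP; apply: measurable_funM => //; exact: measurable_funX.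
Qed.

Let sqw_ge0 h z : 0 <= h z ^+ 2 * w z.
Proof. by apply: mulr_ge0 => //; exact: sqr_ge0. Qed.

Lemma wsq_ge0 h : (0 <= wsq h)%E.
Proof. by apply: integral_ge0 => z _; rewrite lee_fin sqw_ge0. Qed.

Lemma le_wsq (k : R) g h : 0 <= k -> measurable_fun setT g -> measurable_fun setT h ->
  (forall z, D z -> h z ^+ 2 <= k * g z ^+ 2) -> (wsq h <= k%:E * wsq g)%E.
Proof.
move=> k0 mg mh hg; rewrite -ge0_integralZl_EFin//.
- apply: ge0_le_integral => //.
  + by move=> z _; rewrite lee_fin sqw_ge0.
  + exact: measurable_wsq.
  + by under eq_fun do rewrite -EFinM; apply/measurable_EFinP/measurable_funM => //;
      apply/measurable_EFinP/measurable_wsq.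
  + move=> z _; rewrite -EFinM lee_fin mulrA.
    have [Dz|Dz] := pselect (D z); last by rewrite wD// !mulr0.
    by rewrite ler_wpM2r// hg.
- by move=> z _; rewrite lee_fin sqw_ge0.
- exact: measurable_wsq.
Qed.

Lemma eq_wsq g h : (forall z, D z -> g z = h z) -> wsq g = wsq h.
Proof.
move=> gh; apply: eq_integral => z _.
by have [Dz|Dz] := pselect (D z); [rewrite gh|rewrite wD// !mulr0].
Qed.

(** From (g + h)^2 <= 2 g^2 + 2 h^2. It stands in for the triangle inequality, whence the tolerances
    [e / 4] below. *)
Lemma wsqD g h : measurable_fun setT g -> measurable_fun setT h ->
  (wsq (g \+ h)%R <= 2%:E * wsq g + 2%:E * wsq h)%E.
Proof.
move=> mg mh; rewrite -!ge0_integralZl_EFin//; last 4 first.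
- by move=> z _; rewrite lee_fin sqw_ge0.
- exact: measurable_wsq.
- by move=> z _; rewrite lee_fin sqw_ge0.
- exact: measurable_wsq.
have m2 (f : T -> R) : measurable_fun setT f -> measurable_fun setT (fun z => 2%:E * (f z ^+ 2 * w z)%:E)%E.
  move=> mf; under eq_fun do rewrite -EFinM.
  by apply/measurable_EFinP/measurable_funM => //; apply/measurable_EFinP/measurable_wsq.
have p2 (f : T -> R) z : (0 <= 2%:E * (f z ^+ 2 * w z)%:E)%E.
  by rewrite -EFinM lee_fin; apply: mulr_ge0.
rewrite -ge0_integralD//; [|exact: m2|exact: m2].
apply: ge0_le_integral => //.
- by move=> z _; rewrite lee_fin sqw_ge0.
- by apply: measurable_wsq; exact: measurable_funD.
- by apply: emeasurable_funD; exact: m2.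
- move=> z _; rewrite -!EFinM -EFinD lee_fin !mulrA -mulrDl ler_wpM2r//.
  by have := sqr_ge0 (g z - h z); rewrite /=; nra.
Qed.

(** Dominated convergence, with bounds and limits on [D] only, as [w] vanishes elsewhere. *)
Lemma wsq_dominated (u : nat -> T -> R) (G : T -> R) :
  (forall n, measurable_fun setT (u n)) ->
  m.-integrable setT (fun z => (G z * w z)%:E) ->
  (forall n z, D z -> u n z ^+ 2 <= G z) ->
  (forall z, D z -> u n z @[n --> \oo] --> (0 : R)) ->
  wsq (u n) @[n --> \oo] --> 0%E.
Proof.
move=> mu iG uG u0.
have [|||||] // := @dominated_convergence _ _ _ m setT measurableT
  (fun n z => (u n z ^+ 2 * w z)%:E) (cst 0%E) (fun z => (G z * w z)%:E).
- by move=> n; exact: measurable_wsq.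
- apply: aeW => z _; apply: cvg_EFin; first exact: nearW.
  have [Dz|Dz] := pselect (D z); last first.
    by rewrite (_ : fine \o _ = cst 0) ?lim_cst//; [exact: cvg_cst|
       apply/funext => n; rewrite /= wD// mulr0].
  rewrite [X in _ --> X](_ : _ = (0 * 0) * w z); last by rewrite !mul0r.
  apply: cvgMl => /=; under eq_fun do rewrite expr2.
  by apply: cvgM; exact: u0.
- apply: aeW => z n _; rewrite abse_EFin lee_fin ger0_norm ?sqw_ge0//.
  have [Dz|Dz] := pselect (D z); last by rewrite wD// !mulr0.
  by rewrite ler_wpM2r// uG.
- by rewrite integral0 => _ _.
Qed.

Lemma integrableZw (k : R) : m.-integrable setT (fun z => (k * w z)%:E).
Proof.
rewrite (_ : (fun z => _) = (fun z => k%:E * (EFin \o w) z)%E)//.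
exact: integrableZl.
Qed.

(** * Bounded functions approximable by an algebra [A] *)

Variable A : (T -> R) -> Prop.
Hypothesis Acst : forall k, A (cst k).
Hypothesis AD : forall g h, A g -> A h -> A (g \+ h).
Hypothesis AM : forall g h, A g -> A h -> A (g \* h).
Hypothesis mA : forall g, A g -> measurable_fun setT g.
Hypothesis bndA : forall g, A g -> exists C : R, forall z, D z -> `|g z| <= C.

Definition approximable h :=
  forall e : R, 0 < e -> exists2 q, A q & (wsq (h \- q)%R < e%:E)%E.

Lemma approximableD g h : measurable_fun setT g -> measurable_fun setT h ->
  approximable g -> approximable h -> approximable (g \+ h).
Proof.
move=> mg mh ag ah e e0; have e4 : 0 < e / 4 by rewrite divr_gt0.
have [q Aq gq] := ag _ e4; have [r Ar hr] := ah _ e4.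
exists (q \+ r); first exact: AD.
rewrite (_ : _ \- _ = (g \- q) \+ (h \- r)); last first.
  by apply/funext => z /=; rewrite addrACA opprD.
apply: (le_lt_trans (wsqD _ _)).
- by apply: measurable_funB => //; exact: mA.
- by apply: measurable_funB => //; exact: mA.
rewrite (_ : e%:E = 2%:E * (e / 4)%:E + 2%:E * (e / 4)%:E)%E; last first.
  by rewrite -!EFinM -EFinD; congr EFin; field.
by rewrite lteD// lte_pmul2l.
Qed.

Lemma approximable_lim (u : nat -> T -> R) h : measurable_fun setT h ->
  (forall n, measurable_fun setT (u n)) -> (forall n, approximable (u n)) ->
  wsq (h \- u n) @[n --> \oo] --> 0%E -> approximable h.
Proof.
move=> mh mu au uh e e0; have e4 : 0 < e / 4 by rewrite divr_gt0.
have [n _ /(_ _ (leqnn n)) un] := cvge0_near_lt e4 uh.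
have [q Aq uq] := au n _ e4; exists q => //.
rewrite (_ : _ \- _ = (h \- u n) \+ (u n \- q)); last first.
  by apply/funext => z /=; rewrite addrA subrK.
apply: (le_lt_trans (wsqD _ _)).
- exact: measurable_funB.
- by apply: measurable_funB => //; exact: mA.
rewrite (_ : e%:E = 2%:E * (e / 4)%:E + 2%:E * (e / 4)%:E)%E; last first.
  by rewrite -!EFinM -EFinD; congr EFin; field.
by rewrite lteD// lte_pmul2l.
Qed.

(** Boundedness travels with approximability because the error of a product is controlled through
    it. *)
Definition bapprox h := [/\ measurable_fun setT h,
  exists C : R, forall z, D z -> `|h z| <= C & approximable h].

Lemma bapproxA g : A g -> bapprox g.
Proof.
move=> Ag; split; [exact: mA|exact: bndA|move=> e e0; exists g => //].
rewrite (@eq_wsq _ (cst 0)) => [|z _]; last by rewrite /= subrr.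
rewrite /wsq; under eq_integral do rewrite expr0n mul0r.
by rewrite integral0 lte_fin.
Qed.

Lemma bapproxD g h : bapprox g -> bapprox h -> bapprox (g \+ h).
Proof.
move=> [mg [C gC] ag] [mh [C' hC] ah]; split.
- exact: measurable_funD.
- by exists (C + C') => z Dz; rewrite (le_trans (ler_normD _ _))// lerD ?gC ?hC.
- exact: approximableD.
Qed.

Lemma approximable_mulA g q : measurable_fun setT g -> approximable g -> A q ->
  approximable (q \* g).
Proof.
move=> mg ag Aq e e0; have [C qC] := bndA Aq.
(* [C ^+ 2] may vanish; adding 1 makes it a legitimate divisor. *)
have C1 : 0 < C ^+ 2 + 1 by rewrite ltr_wpDl ?sqr_ge0.
have [r Ar gr] := ag _ (divr_gt0 e0 C1).
exists (q \* r); first exact: AM.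
apply: (@le_lt_trans _ _ ((C ^+ 2 + 1)%:E * wsq (g \- r)%R)%E).
- apply: le_wsq; first exact: ltW.
  + by apply: measurable_funB => //; exact: mA.
  + by apply: measurable_funB; apply: measurable_funM => //; exact: mA.
  + move=> z Dz /=; rewrite -mulrBr exprMn ler_wpM2r ?sqr_ge0//.
    rewrite (@le_trans _ _ (C ^+ 2)) ?lerDl// -(real_normK (num_real (q z))).
    by rewrite lerXn2r ?nnegrE ?qC// (le_trans _ (qC _ Dz)).
- rewrite (_ : e%:E = (C ^+ 2 + 1)%:E * (e / (C ^+ 2 + 1))%:E)%E.
    by rewrite lte_pmul2l.
  by rewrite -EFinM; congr EFin; rewrite [RHS]mulrC divfK// gt_eqF.
Qed.

Lemma bapproxM g h : bapprox g -> bapprox h -> bapprox (g \* h).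
Proof.
move=> [mg [C gC] ag] [mh [C' hC] ah]; split.
- exact: measurable_funM.
- exists (C * C') => z Dz; rewrite /= normrM ler_pM ?gC ?hC//.
move=> e e0; have C1 : 0 < C ^+ 2 + 1 by rewrite ltr_wpDl ?sqr_ge0.
have e4 : 0 < e / 4 by rewrite divr_gt0.
(* First [q] approximates [h], with a tolerance scaled by the bound of [g]; then [r] approximates
   [q \* g]. The error splits as g (h - q) + (q g - r). *)
have [q Aq hq] := ah _ (divr_gt0 e4 C1).
have [r Ar gr] := approximable_mulA mg ag Aq e4.
exists r => //.
have mq := mA Aq; have mr := mA Ar.
rewrite (_ : _ \- _ = (g \* (h \- q)) \+ ((q \* g) \- r)); last first.
  by apply/funext => z /=; ring.
apply: (le_lt_trans (wsqD _ _)).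
- by apply: measurable_funM => //; exact: measurable_funB.
- by apply: measurable_funB => //; exact: measurable_funM.
rewrite (_ : e%:E = 2%:E * (e / 4)%:E + 2%:E * (e / 4)%:E)%E; last first.
  by rewrite -!EFinM -EFinD; congr EFin; field.
rewrite lteD// lte_pmul2l//.
apply: (@le_lt_trans _ _ ((C ^+ 2 + 1)%:E * wsq (h \- q)%R)%E).
- apply: le_wsq; first exact: ltW.
  + exact: measurable_funB.
  + by apply: measurable_funM => //; exact: measurable_funB.
  + move=> z Dz /=; rewrite exprMn ler_wpM2r ?sqr_ge0//.
    rewrite (@le_trans _ _ (C ^+ 2)) ?lerDl// -(real_normK (num_real (g z))).
    by rewrite lerXn2r ?nnegrE ?gC// (le_trans _ (gC _ Dz)).
- rewrite (_ : (e / 4)%:E = (C ^+ 2 + 1)%:E * (e / 4 / (C ^+ 2 + 1))%:E)%E.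
    by rewrite lte_pmul2l.
  by rewrite -EFinM; congr EFin; rewrite [RHS]mulrC divfK// gt_eqF.
Qed.

(** The common bound dominates the squared error by the constant [(C + C) ^+ 2], which is integrable
    against [w]. *)
Lemma bapprox_lim (u : nat -> T -> R) h (C : R) : measurable_fun setT h ->
  (forall n, bapprox (u n)) -> (forall n z, D z -> `|u n z| <= C) ->
  (forall z, D z -> `|h z| <= C) ->
  (forall z, D z -> u n z @[n --> \oo] --> h z) -> bapprox h.
Proof.
move=> mh bu uC hC uh; split => //; first by exists C.
have mu n : measurable_fun setT (u n) by have [] := bu n.
apply: (approximable_lim mh mu); first by move=> n; have [] := bu n.
apply: (@wsq_dominated _ (fun=> (C + C) ^+ 2)).
- by move=> n; exact: measurable_funB.
- exact: integrableZw.
- move=> n z Dz; rewrite -(real_normK (num_real (_ - _))) lerXn2r ?nnegrE//.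
    by rewrite addr_ge0// (le_trans _ (hC _ Dz)).
  by rewrite (le_trans (ler_normB _ _))// lerD ?hC ?uC.
- move=> z Dz; rewrite -(subrr (h z)); apply: cvgB; [exact: cvg_cst|exact: uh].
Qed.

Lemma eq_bapprox g h : measurable_fun setT h -> (forall z, D z -> g z = h z) ->
  bapprox g -> bapprox h.
Proof.
move=> mh gh [mg [C gC] ag]; split => //.
  by exists C => z Dz; rewrite -gh// gC.
move=> e e0; have [q Aq gq] := ag _ e0; exists q => //.
by rewrite -(@eq_wsq (g \- q))// => z Dz /=; rewrite gh.
Qed.

Lemma bapprox_iter_smoothstep n g : bapprox g ->
  bapprox (fun z => iter n smoothstep (g z)).
Proof.
move=> bg; elim: n => // n IH.
set h := (fun z => iter n _ _) in IH.
rewrite (_ : (fun z => _) = (h \* h) \* (cst 3 \+ (cst (-2) \* h))).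
  by apply: bapproxM; [exact: bapproxM|apply: bapproxD; [|apply: bapproxM => //];
    exact: bapproxA].
by apply/funext => z; rewrite /h /= /smoothstep; ring.
Qed.

Lemma measurable_superlevel g (r : R) : measurable_fun setT g ->
  measurable [set z | r < g z].
Proof.
move=> mg; rewrite (_ : [set _ | _] = setT `&` g @^-1` `]r, +oo[%classic).
  exact: mg.
by apply/seteqP; split => z /=; rewrite in_itv/= andbT; [move=> ?; split|case].
Qed.

(** An affine change maps [g] into [0, 1] on [D] and the level [r] to 1/2; applying [smoothstep2 n]
    then gives polynomials in [g] that converge boundedly to the indicator. *)
Lemma bapprox_superlevel g (r : R) : bapprox g -> bapprox \1_[set z | r < g z].
Proof.
move=> bg; have [mg [C0 gC0] _] := bg.
pose C := `|C0|; have gC z : D z -> `|g z| <= C.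
  by move=> /gC0 /le_trans; apply; exact: ler_norm.
(* On [D], |g - r| <= C + |r| <= K / 2, so (g - r) / K lies in [-1/2, 1/2]; the added 1 keeps [K]
   positive. *)
pose K := 2 * (C + `|r| + 1).
have K0 : 0 < K by rewrite /K /C; have := normr_ge0 C0; have := normr_ge0 r; lra.
pose h z := 2^-1 + K^-1 * (g z - r).
have bh : bapprox h.
  rewrite (_ : h = cst 2^-1 \+ cst K^-1 \* (g \+ cst (- r)))//.
  apply: bapproxD; first exact: bapproxA.
  apply: bapproxM; first exact: bapproxA.
  by apply: bapproxD => //; exact: bapproxA.
have h01 z : D z -> 0 <= h z <= 1.
  move=> /gC; rewrite ler_norml => /andP[g1 g2].
  have /andP[r1 r2] : - `|r| <= r <= `|r| by rewrite -ler_norml.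
  have Kn : K != 0 by rewrite gt_eqF.
  have -> : h z = (K / 2 + (g z - r)) / K by rewrite /h; field.
  by rewrite divr_ge0 ?ler_pdivrMr// /K; lra.
have hr z : (2^-1 < h z) = (r < g z).
  by rewrite /h ltrDl pmulr_rgt0 ?invr_gt0// subr_gt0.
apply: (@bapprox_lim (fun n z => smoothstep2 n (h z)) _ 1).
- by apply: measurable_indic; exact: measurable_superlevel.
- move=> n; have bi := bapprox_iter_smoothstep n bh.
  set v := (fun z => _) in bi.
  rewrite (_ : (fun z => _) = (cst 2 \* (v \* v)) \+ (cst (-1) \* v)).
    by apply: bapproxD; apply: bapproxM; rewrite -/v//;
      [exact: bapproxA|exact: bapproxM|exact: bapproxA].
  by apply/funext => z; rewrite /v /= /smoothstep2; ring.
- by move=> n z /h01; exact: smoothstep2_bound.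
- by move=> z _; rewrite indicE; case: (_ \in _); rewrite ?normr1 ?normr0.
- move=> z /h01 /cvg_smoothstep2; rewrite hr indicE.
  by rewrite (_ : (z \in _) = (r < g z)) //; apply/idP/idP; rewrite inE.
Qed.

Let G := [set E : set T | measurable E /\ bapprox \1_E].

Let GC E : G E -> G (~` E).
Proof.
move=> [mE bE]; split; first exact: measurableC.
rewrite (_ : \1_ _ = cst 1 \+ (cst (-1) \* \1_E)).
  by apply: bapproxD; [exact: bapproxA|apply: bapproxM => //; exact: bapproxA].
apply/funext => z; rewrite /= !indicE in_setC.
by case: (z \in E); rewrite /= ?mulr0 ?addr0// mulr1 subrr.
Qed.

Let GI E F : G E -> G F -> G (E `&` F).
Proof.
move=> [mE bE] [mF bF]; split; first exact: measurableI.
by rewrite indicI; exact: bapproxM.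
Qed.

Let G0 : G set0.
Proof. by split => //; rewrite indic0; exact: bapproxA. Qed.

(** Complements come from 1 - 1_E and intersections from products, hence finite unions by De Morgan;
    the indicator of a countable union is a limit of theirs, with bound 1. *)
Lemma sigma_algebra_bapprox : sigma_algebra setT G.
Proof.
split => //.
- by move=> E GE; rewrite setTD; exact: GC.
- move=> F GF; pose U n := \big[setU/set0]_(i < n) F i.
  have GU n : G (U n).
    elim: n => [|n IH]; first by rewrite /U big_ord0.
    rewrite /U big_ord_recr -/(U n) /= -(setCK (_ `|` _)) setCU.
    by apply: GC; apply: GI; exact: GC.
  have mF : measurable (\bigcup_k F k).
    by apply: bigcupT_measurable => k; have [] := GF k.
  split => //; apply: (@bapprox_lim (fun n => \1_(U n)) _ 1).
  + exact: measurable_indic.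
  + by move=> n; have [] := GU n.
  + by move=> n z _; rewrite indicE; case: (_ \in _); rewrite ?normr1 ?normr0.
  + by move=> z _; rewrite indicE; case: (_ \in _); rewrite ?normr1 ?normr0.
  + move=> z _; have [[k _ Fz]|nF] := pselect ((\bigcup_k F k) z).
      apply: cvg_near_cst; exists k.+1 => // n /= kn.
      have Uz : U n z by rewrite /U -bigcup_mkord; exists k.
      by rewrite !indicE !mem_set//; exists k.
    apply: cvg_near_cst; apply: nearW => n; rewrite !indicE !memNset//.
    by rewrite /U -bigcup_mkord => -[k _ Fz]; apply: nF; exists k.
Qed.

(** The superlevel sets of [A] have to generate the measurable sets only up to changes outside [D];
    this lets t^2 do the work of t where t >= 0. *)
Hypothesis genA : forall H : set (set T), sigma_algebra setT H ->
  (forall g (r : R), A g -> H [set z | r < g z]) ->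
  (forall E F, measurable F -> E `&` D = F `&` D -> H E -> H F) ->
  measurable `<=` H.

Lemma bapprox_indic E : measurable E -> bapprox \1_E.
Proof.
move=> mE; suff [] : G E by [].
move: E mE; apply: genA; first exact: sigma_algebra_bapprox.
- move=> g r Ag; split; first by apply: measurable_superlevel; exact: mA.
  by apply: bapprox_superlevel; exact: bapproxA.
- move=> E F mF EF [mE bE]; split => //.
  apply: eq_bapprox bE; first exact: measurable_indic.
  move=> z Dz; rewrite !indicE; congr (_%:R).
  have EFz : E z <-> F z.
    have /seteqP[s1 s2] := EF; split => Hz.
      by have [] := s1 z (conj Hz Dz).
    by have [] := s2 z (conj Hz Dz).
  by apply: congr1; apply/idP/idP; rewrite !inE => /EFz.
Qed.

Import HBNNSimple.

Lemma bapprox_nnsfun (g : {nnsfun T >-> R}) : bapprox g.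
Proof.
rewrite (_ : (g : T -> R) = fun z => \sum_(y <- finmap.enum_fset (fset_set (range g)))
    (y * \1_(g @^-1` [set y]) z)); last first.
  by apply/funext => z; rewrite fimfunE fsbig_finite.
elim: (finmap.enum_fset _) => [|y s IH].
  by under eq_fun do rewrite big_nil; exact: (bapproxA (Acst 0)).
under eq_fun do rewrite big_cons.
apply: (bapproxD (g := cst y \* \1_(g @^-1` [set y]))) => //.
apply: bapproxM; first exact: bapproxA.
exact: bapprox_indic.
Qed.

(** Simple functions g_n increase to [h], and (h - g_n)^2 <= h^2 provides the integrable
    majorant. *)
Lemma approximable_ge0 h : measurable_fun setT h -> (forall z, 0 <= h z) ->
  (wsq h < +oo)%E -> approximable h.
Proof.
move=> mh h0 fh; have meh : measurable_fun setT (EFin \o h) by exact/measurable_EFinP.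
pose g := nnsfun_approx measurableT meh.
have gh z : g n z @[n --> \oo] --> h z.
  have := @cvg_nnsfun_approx _ _ _ _ measurableT _ meh (fun x _ => h0 x) z I.
  by move=> /fine_cvgP[_].
have gle n z : g n z <= h z.
  rewrite -lee_fin /g nnsfun_approxE.
  by apply: (@le_approx _ _ _ setT (EFin \o h)) => // x _; rewrite lee_fin.
apply: (@approximable_lim (fun n => g n)) => //.
- by move=> n; have [] := bapprox_nnsfun (g n).
- apply: (@wsq_dominated _ (fun z => h z ^+ 2)).
  + by move=> n; exact: measurable_funB.
  + apply/integrableP; split; first exact: measurable_wsq.
    under eq_integral do rewrite abse_EFin ger0_norm ?sqw_ge0//.
    exact: fh.
  + move=> n z _; rewrite lerXn2r ?nnegrE ?subr_ge0 ?gle//.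
    by rewrite gerBl.
  + move=> z _; rewrite -(subrr (h z)); apply: cvgB; [exact: cvg_cst|exact: gh].
Qed.

Lemma approximable_L2 h : measurable_fun setT h -> (wsq h < +oo)%E ->
  approximable h.
Proof.
move=> mh fh.
pose p z := Num.max (h z) 0; pose q z : R := Num.max (- h z) 0.
have mp : measurable_fun setT p by exact: measurable_maxr.
have mq : measurable_fun setT q by apply: measurable_maxr => //; exact: measurable_funN.
have small (f : T -> R) : measurable_fun setT f -> (forall z, f z ^+ 2 <= h z ^+ 2) ->
    (wsq f < +oo)%E.
  move=> mf fh2; apply: le_lt_trans fh; rewrite -[leRHS]mul1e.
  by apply: le_wsq => // z _; rewrite mul1r.
have ap : approximable p.
  apply: approximable_ge0 => //; first by move=> z; rewrite /p le_max lexx orbT.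
  apply: small => // z; rewrite /p; case: (leP (h z) 0) => _ //.
  by rewrite expr0n sqr_ge0.
have aq : approximable q.
  apply: approximable_ge0 => //; first by move=> z; rewrite /q le_max lexx orbT.
  apply: small => // z; rewrite /q; case: (leP (- h z) 0) => _; last by rewrite sqrrN.
  by rewrite expr0n sqr_ge0.
rewrite (_ : h = p \+ (cst (-1) \* q)); last first.
  apply/funext => z; rewrite /p /q /= mulN1r oppr_max oppr0 opprK.
  by rewrite -[LHS](addr0) addr_max_min.
apply: approximableD => //.
- exact: measurable_funM.
- by apply: approximable_mulA.
Qed.

End weighted_density.

(** * Orthogonal projection on a finite span *)

Section gram_schmidt.
Context {R : realType} (V : lmodType R) (L : V -> Prop) (B : V -> V -> R).
Hypothesis LD : forall x y, L x -> L y -> L (x + y).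
Hypothesis LZ : forall k x, L x -> L (k *: x).
Hypothesis BC : forall x y, B x y = B y x.
Hypothesis BD : forall x y z, L x -> L y -> L z -> B (x + y) z = B x z + B y z.
Hypothesis BZ : forall k x y, L x -> L y -> B (k *: x) y = k * B x y.
Hypothesis B_ge0 : forall x, L x -> 0 <= B x x.

Let LB x y : L x -> L y -> L (x - y).
Proof. by move=> Lx Ly; rewrite -scaleN1r; apply: LD => //; exact: LZ. Qed.

Lemma bformBl x y z : L x -> L y -> L z -> B (x - y) z = B x z - B y z.
Proof.
move=> Lx Ly Lz; rewrite -scaleN1r BD//; last exact: LZ.
by rewrite BZ// mulN1r.
Qed.

Lemma bformDr x y z : L x -> L y -> L z -> B x (y + z) = B x y + B x z.
Proof. by move=> *; rewrite BC BD// ![B _ x]BC. Qed.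

Lemma bformZr k x y : L x -> L y -> B x (k *: y) = k * B x y.
Proof. by move=> *; rewrite BC BZ// ![B _ x]BC. Qed.

(** [B] is only positive semidefinite on [L]: a function that vanishes almost everywhere has norm 0.
    This degenerate case of the Cauchy-Schwarz inequality takes the place of definiteness. *)
Lemma bform_degenerate x y : L x -> L y -> B y y = 0 -> B x y = 0.
Proof.
move=> Lx Ly yy; apply/eqP/negPn/negP => xy.
(* For this [t] the value of [B] at x + t y, namely B x x + 2 t B x y, would be -1. *)
pose t := - (B x x + 1) / (2 * B x y).
have Lt : L (t *: y) by exact: LZ.
have := B_ge0 (LD Lx Lt).
rewrite BD//; last exact: LD.
rewrite !bformDr// !BZ// !bformZr// yy [B y x]BC.
rewrite (_ : _ + _ = -1) ?ler0N1//.
by rewrite /t; field.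
Qed.

Fixpoint span_seq (s : seq V) (r : V) : Prop :=
  match s with
  | [::] => r = 0
  | e :: s' => exists k r', span_seq s' r' /\ r = k *: e + r'
  end.

Fixpoint allP (P : V -> Prop) (s : seq V) : Prop :=
  match s with [::] => True | e :: s' => P e /\ allP P s' end.

Lemma allP_imp (P Q : V -> Prop) s : (forall x, P x -> Q x) -> allP P s -> allP Q s.
Proof. by move=> PQ; elim: s => //= x s IH [/PQ Qx /IH]. Qed.

Lemma allP_and (P Q : V -> Prop) s : allP P s -> allP Q s ->
  allP (fun x => P x /\ Q x) s.
Proof. by elim: s => //= x s IH [Px Ps] [Qx Qs]; split => //; exact: IH. Qed.

Lemma span_seqB s k x y : span_seq s x -> span_seq s y -> span_seq s (x - k *: y).
Proof.
elim: s x y => [|e s IH] x y /=; first by move=> -> ->; rewrite scaler0 subr0.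
move=> [a [x' [sx ->]]] [b [y' [sy ->]]].
exists (a - k * b), (x' - k *: y'); split; first exact: IH.
by rewrite scalerDr scalerBl scalerA opprD addrACA.
Qed.

Lemma span_seq_ind (P : V -> Prop) s r : P 0 ->
  (forall k x y, P x -> P y -> P (k *: x + y)) -> allP P s -> span_seq s r -> P r.
Proof.
move=> P0 PD; elim: s r => [r _ -> //|e s IH r [Pe Ps] [k [r' [sr ->]]]].
by apply: PD => //; exact: IH.
Qed.

Hypothesis L0 : L 0.

Lemma span_seqL s r : allP L s -> span_seq s r -> L r.
Proof. by apply: span_seq_ind => // k x y Lx Ly; apply: LD => //; exact: LZ. Qed.

Lemma orthogonal_span x s r : L x -> allP L s ->
  allP (fun e => B x e = 0) s -> span_seq s r -> B x r = 0.
Proof.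
move=> Lx Ls xs sr.
suff [] : L r /\ B x r = 0 by [].
apply: (span_seq_ind _ _ (allP_and Ls xs) sr).
  by split => //; have := BZ 0 L0 Lx; rewrite scale0r mul0r BC.
move=> k y z [Ly xy] [Lz xz]; split; first by apply: LD => //; exact: LZ.
by rewrite bformDr ?bformZr ?xy ?xz ?mulr0 ?addr0//; exact: LZ.
Qed.

(** Gram-Schmidt: with [u] and [v] the projections of [e] and [p] on the span of the tail, subtract
    from p - v its component along e - u. *)
Lemma orthogonal_projection s p : allP L s -> L p ->
  exists2 r, span_seq s r & allP (fun e => B (p - r) e = 0) s.
Proof.
elim: s p => [|e s IH] p /=; first by exists 0.
move=> [Le Ls] Lp.
have [u su ou] := IH e Ls Le; have [v sv ov] := IH p Ls Lp.
have Lu := span_seqL Ls su; have Lv := span_seqL Ls sv.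
have Leu : L (e - u) by exact: LB.
have Lpv : L (p - v) by exact: LB.
(* If e - u has norm 0, then p - v is already orthogonal to it and 0 serves as the coefficient. *)
have [k kP] : exists k, B (p - v) (e - u) = k * B (e - u) (e - u).
  have [z|nz] := eqVneq (B (e - u) (e - u)) 0.
    by exists 0; rewrite mul0r (bform_degenerate Lpv Leu z).
  by exists (B (p - v) (e - u) / B (e - u) (e - u)); rewrite divfK.
have rE : p - (k *: e + (v - k *: u)) = (p - v) - k *: (e - u).
  by rewrite scalerBr [_ + (v - _)]addrCA opprD addrA.
exists (k *: e + (v - k *: u)).
  by exists k, (v - k *: u); split => //; exact: span_seqB.
have Lk : L (k *: (e - u)) by exact: LZ.
have orths : allP (fun e' => B (p - (k *: e + (v - k *: u))) e' = 0) s.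
  apply: allP_imp (allP_and Ls (allP_and ov ou)) => x [Lx [vx ux]].
  by rewrite rE bformBl// BZ// vx ux mulr0 subrr.
split => //.
(* Split [e] as (e - u) + u: the second term lies in the span of [s], and [k] was chosen for the
   first. *)
rewrite -{2}(subrK u e) bformDr//; last by rewrite rE; exact: LB.
rewrite (orthogonal_span _ Ls orths su); last by rewrite rE; exact: LB.
by rewrite addr0 rE bformBl// BZ// kP subrr.
Qed.

End gram_schmidt.

(** * The weighted inner product *)

Section weighted_inner_product.
Context d (T : measurableType d) {R : realType}.
Context (m : {measure set T -> \bar R}) (D : set T) (w : T -> R).
Hypothesis mw : measurable_fun setT w.
Hypothesis w0 : forall z, 0 <= w z.
Hypothesis wD : forall z, ~ D z -> w z = 0.
Hypothesis iw : m.-integrable setT (EFin \o w).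
Implicit Types g h : T -> R.

Definition wL2 h := measurable_fun setT h /\ (wsq m w h < +oo)%E.

(** Real-valued, as the bilinear-form lemmas require; on [wL2] the integral is finite and [fine]
    loses nothing ([wipE]). *)
Definition wip g h : R := fine (\int[m]_z (g z * h z * w z)%:E)%E.

Lemma wL2D g h : wL2 g -> wL2 h -> wL2 (g + h).
Proof.
move=> [mg fg] [mh fh]; split; first exact: measurable_funD.
apply: le_lt_trans (wsqD m mw w0 mg mh) _.
by rewrite lte_add_pinfty// lte_mul_pinfty.
Qed.

(** The codomain [R^o] is [R] as a module over itself; it makes the functions a vector space, to
    which Gram-Schmidt applies. *)
Lemma wL2Z k h : wL2 h -> wL2 (k *: h : T -> R^o).
Proof.
move=> [mh fh]; have mk : measurable_fun setT (k *: h : T -> R^o).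
  by apply: measurable_funM.
split => //.
apply: (@le_lt_trans _ _ ((k ^+ 2)%:E * wsq m w h)%E).
  by apply: (le_wsq m mw w0 wD) => // [|z _]; rewrite ?sqr_ge0// [_ z]/= exprMn.
by rewrite lte_mul_pinfty// lee_fin sqr_ge0.
Qed.

Lemma wL2_bounded h (C : R) : measurable_fun setT h ->
  (forall z, D z -> `|h z| <= C) -> wL2 h.
Proof.
move=> mh hC; split => //.
apply: (@le_lt_trans _ _ ((C ^+ 2)%:E * wsq m w (cst 1%R : T -> R))%E).
  apply: (le_wsq m mw w0 wD) => // [|z Dz]; rewrite ?sqr_ge0//.
  rewrite expr1n mulr1 -(real_normK (num_real (h z))).
  by rewrite lerXn2r ?nnegrE ?hC// (le_trans _ (hC _ Dz)).
rewrite lte_mul_pinfty ?lee_fin ?sqr_ge0//.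
have /integrableP[_] := iw; rewrite /wsq.
under eq_integral do rewrite /= ger0_norm//.
by under [X in _ -> (X < _)%E]eq_integral do rewrite expr1n mul1r.
Qed.

Lemma integrable_wsq h : wL2 h ->
  m.-integrable setT (fun z => (h z ^+ 2 * w z)%:E).
Proof.
move=> [mh fh]; apply/integrableP; split.
  by apply/measurable_EFinP; apply: measurable_funM => //; exact: measurable_funX.
have h2 z : 0 <= h z ^+ 2 * w z by apply: mulr_ge0 => //; exact: sqr_ge0.
by under eq_integral do rewrite abse_EFin ger0_norm ?h2//; exact: fh.
Qed.

(** Because |g h| <= g^2 + h^2. *)
Lemma integrable_wip g h : wL2 g -> wL2 h ->
  m.-integrable setT (fun z => (g z * h z * w z)%:E).
Proof.
move=> Lg Lh; have [mg _] := Lg; have [mh _] := Lh.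
apply: (@le_integrable _ _ _ _ _ measurableT _
  (fun z => (g z ^+ 2 * w z)%:E + (h z ^+ 2 * w z)%:E)%E).
- apply/measurable_EFinP; apply: measurable_funM => //; exact: measurable_funM.
- move=> z _; rewrite -EFinD !abse_EFin lee_fin -mulrDl !normrM.
  rewrite (ger0_norm (w0 z)) ler_wpM2r// [leRHS]ger0_norm ?addr_ge0 ?sqr_ge0//.
  rewrite -(real_normK (num_real (g z))) -(real_normK (num_real (h z))).
  by have := sqr_ge0 (`|g z| - `|h z|); have := normr_ge0 (g z); have := normr_ge0 (h z); nra.
- by apply: integrableD => //; exact: integrable_wsq.
Qed.

Lemma wipE g h : wL2 g -> wL2 h ->
  (\int[m]_z (g z * h z * w z)%:E)%E = (wip g h)%:E.
Proof.
by move=> Lg Lh; rewrite /wip fineK//; apply: integrable_fin_num => //; exact: integrable_wip.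
Qed.

Lemma wsqE h : wL2 h -> wsq m w h = (wip h h)%:E.
Proof. by move=> Lh; rewrite -wipE// /wsq; under eq_integral do rewrite expr2. Qed.

Lemma wipC g h : wip g h = wip h g.
Proof. by rewrite /wip; congr fine; apply: eq_integral => z _; rewrite [g z * _]mulrC. Qed.

Lemma wipD f g h : wL2 f -> wL2 g -> wL2 h -> wip (f + g) h = wip f h + wip g h.
Proof.
move=> Lf Lg Lh; apply: EFin_inj; rewrite EFinD -!wipE//; last exact: wL2D.
rewrite -integralD//; [|exact: integrable_wip|exact: integrable_wip].
by apply: eq_integral => z _; rewrite -EFinD -!mulrDl.
Qed.

Lemma wipZ k g h : wL2 g -> wL2 h -> wip (k *: g : T -> R^o) h = k * wip g h.
Proof.
move=> Lg Lh; apply: EFin_inj; rewrite EFinM -!wipE//; last exact: wL2Z.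
rewrite -integralZl//; last exact: integrable_wip.
by apply: eq_integral => z _; rewrite -EFinM !mulrA.
Qed.

Lemma wip_ge0 h : wL2 h -> 0 <= wip h h.
Proof. by move=> Lh; rewrite -lee_fin -wsqE// wsq_ge0. Qed.

End weighted_inner_product.

(** * Polynomials even in t *)

Section polynomials.
Context {R : realType} {d : nat}.
Implicit Types p q : pt R d -> R.

Definition mono (al : 'I_d -> nat) k : pt R d -> R :=
  fun z => (\prod_(i < d) tnth z.1 i ^+ al i) * z.2 ^+ k.

Definition mdeg (al : 'I_d -> nat) k := (\sum_(i < d) al i + k)%N.

(** An inductive form of [is_poly], with exponents in [nat], that gives closure under sums and
    products by induction. The two agree by [is_poly_polyn] and [polyn_is_poly]. *)
Inductive polyn (n : nat) : (pt R d -> R) -> Prop :=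
| polyn0 : polyn n (cst 0)
| polyn_cons c al k p : (mdeg al k <= n)%N -> polyn n p ->
    polyn n ((fun z => c * mono al k z) \+ p).

Lemma polyn_mono n c al k : (mdeg al k <= n)%N ->
  polyn n (fun z => c * mono al k z).
Proof.
move=> kn; have := polyn_cons c kn (polyn0 n).
by congr polyn; apply/funext => z; rewrite /= addr0.
Qed.

Lemma polynD n p q : polyn n p -> polyn n q -> polyn n (p \+ q).
Proof.
move=> np nq; elim: np => [|c al k p' kn _ IH].
  by move: nq; congr polyn; apply/funext => z; rewrite /= add0r.
have := polyn_cons c kn IH.
by congr polyn; apply/funext => z; rewrite /= addrA.
Qed.

Lemma polyn_sum n (I : Type) (s : seq I) (F : I -> pt R d -> R) :
  (forall i, polyn n (F i)) -> polyn n (fun z => \sum_(i <- s) F i z).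
Proof.
move=> nF; elim: s => [|i s IH]; first by under eq_fun do rewrite big_nil; exact: polyn0.
by under eq_fun do rewrite big_cons; exact: (polynD (nF i) IH).
Qed.

Lemma polyn_leq n m p : (n <= m)%N -> polyn n p -> polyn m p.
Proof.
move=> nm; elim => [|c al k p' kn _ IH]; first exact: polyn0.
by apply: polyn_cons => //; exact: leq_trans nm.
Qed.

Lemma monoM al k al' k' z :
  mono al k z * mono al' k' z = mono (fun i => al i + al' i)%N (k + k') z.
Proof.
rewrite /mono exprD mulrACA -big_split/=; congr (_ * _).
by apply: eq_bigr => i _; rewrite exprD.
Qed.

Lemma polynM n m p q : polyn n p -> polyn m q -> polyn (n + m) (p \* q).
Proof.
move=> np mq; elim: np => [|c al k p' kn _ IH].
  by have := polyn0 (n + m); congr polyn; apply/funext => z; rewrite /= mul0r.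
rewrite (_ : _ \* _ = ((fun z => c * mono al k z) \* q) \+ (p' \* q)); last first.
  by apply/funext => z; rewrite /= mulrDl.
apply: polynD => //; elim: mq => [|c' al' k' q' km _ IH'].
  by have := polyn0 (n + m); congr polyn; apply/funext => z; rewrite /= mulr0.
have kk : (mdeg (fun i => al i + al' i) (k + k') <= n + m)%N.
  by rewrite /mdeg big_split/= addnACA leq_add.
have := polyn_cons (c * c') kk IH'.
by congr polyn; apply/funext => z; rewrite /= -monoM; ring.
Qed.

Lemma polynZ n (c : R) p : polyn n p -> polyn n (fun z => c * p z).
Proof.
move=> np; elim: np => [|c' al k p' kn _ IH].
  by have := polyn0 n; congr polyn; apply/funext => z; rewrite /= mulr0.
have := polyn_cons (c * c') kn IH.
by congr polyn; apply/funext => z; rewrite /= mulrDr mulrA.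
Qed.

Lemma polyn_reflect n p : polyn n p -> polyn n (fun z => p (z.1, - z.2)).
Proof.
elim => [|c al k p' kn _ IH]; first exact: polyn0.
have := polyn_cons (c * (-1) ^+ k) kn IH.
congr polyn; apply/funext => z; rewrite /= /mono/= -[- z.2]mulN1r exprMn.
by congr (_ + _); ring.
Qed.

Lemma polyn_cst (k : R) : polyn 0 (cst k).
Proof.
have k0 : (mdeg (fun=> 0) 0 <= 0)%N by rewrite /mdeg big1.
have := polyn_mono k k0; congr polyn; apply/funext => z.
by rewrite /mono big1 ?mulr1.
Qed.

Lemma polyn_coord (i : 'I_d) : polyn 1 (fun z => tnth z.1 i).
Proof.
have k0 : (mdeg (fun j => j == i) 0 <= 1)%N.
  by rewrite /mdeg (bigD1 i)//= eqxx big1// => j /negPf ->.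
have := polyn_mono 1 k0; congr polyn; apply/funext => z.
rewrite /mono expr0 mulr1 mul1r (bigD1 i)//= eqxx expr1 big1 ?mulr1//.
by move=> j /negPf ->; rewrite expr0.
Qed.

Lemma polyn_t2 : polyn 2 (fun z => z.2 ^+ 2).
Proof.
have k0 : (mdeg (fun=> 0) 2 <= 2)%N by rewrite /mdeg big1.
have := polyn_mono 1 k0; congr polyn; apply/funext => z.
by rewrite /mono big1 ?mul1r.
Qed.

Lemma is_poly_polyn n p : is_poly n p -> polyn n p.
Proof.
move=> [cf [cf0 pE]].
rewrite (_ : p = fun z => \sum_(al : {ffun 'I_d -> 'I_n.+1}) \sum_(k < n.+1)
   cf al k * mono (fun i => al i) k z); last first.
  apply/funext => -[x t]; rewrite pE; apply: eq_bigr => al _.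
  by apply: eq_bigr => k _; rewrite /mono mulrA.
apply: polyn_sum => al; apply: polyn_sum => k.
have [kn|nk] := leqP (mdeg (fun i => al i) k) n; first exact: polyn_mono.
by rewrite cf0//; have := polyn0 n; congr polyn; apply/funext => z; rewrite mul0r.
Qed.

Lemma is_poly0 n : is_poly n (cst 0 : pt R d -> R).
Proof.
exists (fun _ _ => 0); split => // x t.
by rewrite big1// => al _; rewrite big1// => k _; rewrite !mul0r.
Qed.

Lemma is_polyD n p q : is_poly n p -> is_poly n q -> is_poly n (p \+ q).
Proof.
move=> [cf [cf0 pE]] [cf' [cf0' qE]].
exists (fun al k => cf al k + cf' al k); split.
  by move=> al k kn; rewrite cf0// cf0'// addr0.
move=> x t; rewrite /= pE qE -big_split; apply: eq_bigr => al _ /=.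
by rewrite -big_split; apply: eq_bigr => k _ /=; rewrite !mulrDl.
Qed.

Lemma is_poly_mono n c al k : (mdeg al k <= n)%N ->
  is_poly n (fun z : pt R d => c * mono al k z).
Proof.
move=> kn.
have kn' : (k < n.+1)%N by rewrite ltnS (leq_trans _ kn)// leq_addl.
have aln i : (al i < n.+1)%N.
  by rewrite ltnS (leq_trans _ kn)// /mdeg (bigD1 i)//= -addnA leq_addr.
pose al0 : {ffun 'I_d -> 'I_n.+1} := [ffun i => Ordinal (aln i)].
pose k0 := Ordinal kn'.
exists (fun al' k' => if (al' == al0) && (k' == k0) then c else 0); split.
  move=> al' k'; case: ifP => // /andP[/eqP -> /eqP ->].
  by under eq_bigr do rewrite ffunE/=; rewrite ltnNge -/(mdeg al k) kn.
move=> x t; rewrite (bigD1 al0)//= [X in _ + X](_ : _ = 0) ?addr0; last first.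
  by apply: big1 => al' /negPf ->; rewrite big1// => k' _; rewrite !mul0r.
rewrite (bigD1 k0)//= [X in _ + X](_ : _ = 0) ?addr0; last first.
  by apply: big1 => k' /negPf ->; rewrite andbF !mul0r.
rewrite !eqxx /mono /= -mulrA; congr (_ * (_ * _)).
by apply: eq_bigr => i _; rewrite ffunE.
Qed.

Lemma polyn_is_poly n p : polyn n p -> is_poly n p.
Proof.
elim => [|c al k p' kn _ IH]; first exact: is_poly0.
by apply: is_polyD => //; exact: is_poly_mono.
Qed.

Definition evenpoly n p := polyn n p /\ even_t p.

Lemma evenpolyD n p q : evenpoly n p -> evenpoly n q -> evenpoly n (p \+ q).
Proof.
move=> [np ep] [nq eq_]; split; first exact: polynD.
by move=> x t; rewrite /= ep eq_.
Qed.

Lemma evenpolyZ n c p : evenpoly n p -> evenpoly n (fun z => c * p z).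
Proof.
move=> [np ep]; split; first exact: polynZ.
by move=> x t; rewrite ep.
Qed.

Lemma evenpolyM n m p q : evenpoly n p -> evenpoly m q ->
  evenpoly (n + m) (p \* q).
Proof.
move=> [np ep] [nq eq_]; split; first exact: polynM.
by move=> x t; rewrite /= ep eq_.
Qed.

Lemma evenpoly_leq n m p : (n <= m)%N -> evenpoly n p -> evenpoly m p.
Proof. by move=> nm [np ep]; split => //; exact: polyn_leq np. Qed.

Lemma evenpoly0 n : evenpoly n (cst 0).
Proof. by split => //; exact: polyn0. Qed.

(** Monomials of too large a degree or odd in t are replaced by 0, so that the generators share the
    index type of the coefficients in [is_poly]. *)
Definition evengen n (i : {ffun 'I_d -> 'I_n.+1} * 'I_n.+1) : pt R d -> R^o :=
  if (mdeg (fun j => i.1 j) i.2 <= n)%N && ~~ odd i.2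
  then mono (fun j => i.1 j) i.2 else cst 0.

Definition evengens n : seq (pt R d -> R^o) :=
  [seq evengen i | i <- index_enum ({ffun 'I_d -> 'I_n.+1} * 'I_n.+1)%type].

Lemma allP_evengens n : allP (evenpoly n) (evengens n).
Proof.
rewrite /evengens; elim: (index_enum _) => //= i s IH; split => //.
rewrite /evengen; case: ifPn => [/andP[kn ok]|_]; last exact: evenpoly0.
split.
  by have := polyn_mono 1 kn; congr polyn; apply/funext => z; rewrite mul1r.
by move=> x t; rewrite /mono/= -[- t]mulN1r exprMn -signr_odd (negPf ok) mul1r.
Qed.

Lemma span_seq_evengens n p : evenpoly n p -> span_seq (evengens n) p.
Proof.
move=> [/polyn_is_poly [cf [cf0 pE]] ep].
rewrite (_ : p = \sum_(i : {ffun 'I_d -> 'I_n.+1} * 'I_n.+1) cf i.1 i.2 *: evengen i).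
  rewrite /evengens; elim: (index_enum _) => [|i s IH] /=; first by rewrite big_nil.
  by rewrite big_cons; exists (cf i.1 i.2), (\sum_(j <- s) cf j.1 j.2 *: evengen j).
apply/funext => -[x t].
(* Averaging over t and -t cancels the odd powers of t, without any appeal to uniqueness of the
   coefficients. *)
rewrite fct_sumE; transitivity (2^-1 * (p (x, t) + p (x, - t))).
  by rewrite ep; field.
rewrite !pE -big_split/= mulr_sumr.
rewrite -(pair_big xpredT xpredT (fun al k => (cf al k *: evengen (al, k)) (x, t))) /=.
apply: eq_bigr => al _; rewrite -big_split/= mulr_sumr; apply: eq_bigr => k _.
have [kn|nk] := leqP (mdeg (fun j => al j) k) n; last first.
  by rewrite cf0// scale0r !mul0r addr0 mulr0.
rewrite /evengen /= kn /= -[- t]mulN1r exprMn -signr_odd.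
case: (odd k) => /=; rewrite /mono/= ?expr0 ?expr1.
  by rewrite -[RHS]/(cf al k * 0); ring.
by rewrite -[RHS]/(cf al k * ((\prod_(i < d) tnth x i ^+ al i) * t ^+ k)); field.
Qed.

Lemma span_evengens_evenpoly n p : span_seq (evengens n) p -> evenpoly n p.
Proof.
apply: span_seq_ind; first exact: evenpoly0; last exact: allP_evengens.
move=> k q r Eq Er; exact: (evenpolyD (evenpolyZ k Eq) Er).
Qed.

Lemma measurable_polyn n p : polyn n p -> measurable_fun setT p.
Proof.
elim => [|c al k p' kn _ IH]; first exact: measurable_cst.
apply: measurable_funD => //; apply: measurable_funM => //.
apply: measurable_funM.
  apply: measurable_prod => i _; apply: measurable_funX.
  by apply: (measurableT_comp (measurable_tnth i)).
by apply: measurable_funX; exact: measurable_snd.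
Qed.

Lemma polyn_bounded n p (M : R) : polyn n p ->
  exists C : R, forall z, (forall i, `|tnth z.1 i| <= 1) -> `|z.2| <= M ->
    `|p z| <= C.
Proof.
elim => [|c al k p' kn _ [C pC]]; first by exists 0 => z _ _; rewrite normr0.
exists (`|c| * (1 * M ^+ k) + C) => z z1 z2.
rewrite (le_trans (ler_normD _ _))// lerD ?pC// !normrM ler_wpM2l//.
rewrite ler_pM//; last by rewrite normrX lerXn2r ?nnegrE// (le_trans _ z2).
by rewrite normr_prod prodr_ile1// => i _; rewrite normr_ge0 normrX exprn_ile1.
Qed.

Lemma measurable_superlevels_gen (Tp : pointedType) (H : set (set Tp)) (f : Tp -> R) :
  (forall r, H [set z | r < f z]) ->
  measurable_fun [set: g_sigma_algebraType H] (f : g_sigma_algebraType H -> R).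
Proof.
move=> Hf; apply: (measurability _ (RGenOInfty.measurableE R)).
move=> _ [_ [r ->] <-]; rewrite setTI; apply: sub_sigma_algebra.
rewrite (_ : _ @^-1` _ = [set z | r < f z])//.
by apply/seteqP; split => z /=; rewrite in_itv/= andbT.
Qed.

(* On points with [t >= 0] the sets [t > r] are superlevel sets of the even
   polynomial [t^2]. *)
Lemma evenpoly_generate (D : set (pt R d)) (H : set (set (pt R d))) :
  (forall z, D z -> 0 <= z.2) -> sigma_algebra setT H ->
  (forall g (r : R), (exists n, evenpoly n g) -> H [set z | r < g z]) ->
  (forall E F, measurable F -> E `&` D = F `&` D -> H E -> H F) ->
  measurable `<=` H.
Proof.
move=> D0 sH HA HD E mE.
pose f1 : g_sigma_algebraType H -> d.-tuple R := fst.
pose f2 : g_sigma_algebraType H -> R := snd.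
(* The identity map, from the sigma-algebra [H] to the product one, is measurable coordinate by
   coordinate; then every measurable [E] is its own preimage and belongs to [H]. *)
have midH : measurable_fun setT (fun z => (f1 z, f2 z)).
  apply: measurable_fun_pair.
    apply/measurable_fun_tnthP => i; apply: measurable_superlevels_gen => r /=.
    by apply: HA; exists 1%N; split => //; exact: polyn_coord.
  apply: measurable_superlevels_gen => r.
  have mr : measurable [set z : pt R d | r < z.2].
    rewrite (_ : [set _ | _] = setT `&` snd @^-1` `]r, +oo[%classic).
      exact: measurable_snd.
    by apply/seteqP; split => z /=; rewrite in_itv/= andbT; [move=> ?; split|case].
  have [r0|r0] := leP 0 r.
    apply: (HD [set z : pt R d | r ^+ 2 < z.2 ^+ 2]) => //.
      apply/seteqP; split => z [/= rz Dz]; split => //; move: rz.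
        by rewrite ltr_pXn2r ?nnegrE//; exact: D0.
      by rewrite ltr_pXn2r ?nnegrE//; exact: D0.
    apply: HA; exists 2%N; split; first exact: polyn_t2.
    by move=> x t /=; rewrite sqrrN.
  (* For r < 0 all of [D] satisfies t > r, and the whole space is a superlevel set of the constant
     1. *)
  apply: (HD [set z : pt R d | 0 < (cst 1 : pt R d -> R) z]) => //.
    apply/seteqP; split => z [/= rz Dz]; split => //=.
    by rewrite (lt_le_trans r0)// D0.
  by apply: HA; exists 0%N; split => //; exact: polyn_cst.
have := midH measurableT E mE.
rewrite setTI (_ : _ @^-1` E = E); last by apply/seteqP; split => -[].
by rewrite measurable_g_measurableTypeE.
Qed.

End polynomials.

(** * One-dimensional improper integrals *)

Section improper_integrals.
Context {R : realType}.
Local Notation leb := (@lebesgue_measure R).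
Implicit Types (f F : R -> R) (x y r s t C : R).

Lemma continuous_oo_measurable f x y :
  (forall t, x < t < y -> {for t, continuous f}) -> measurable_fun `]x, y[ f.
Proof.
move=> cf; apply: open_continuous_measurable_fun; first exact: interval_open.
by move=> t; rewrite inE /= in_itv/=; exact: cf.
Qed.

Lemma is_derive_continuous f t (df : R) : is_derive t 1 f df -> {for t, continuous f}.
Proof.
move=> D; apply: differentiable_continuous; apply/derivable1_diffP.
exact: ex_derive.
Qed.

(** The fundamental theorem of calculus on compact subintervals, then monotone convergence. Only
    increments of [F] inside the open interval are bounded, so [f] may blow up at the endpoints. *)
Lemma ge0_integral_oo_le f F x y C : x < y ->
  (forall t, x < t < y -> 0 <= f t) ->
  (forall t, x < t < y -> {for t, continuous f}) ->
  (forall t, x < t < y -> is_derive t 1 F (f t)) ->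
  (forall s t, x < s < y -> x < t < y -> F t - F s <= C) ->
  (\int[leb]_(t in `]x, y[) (f t)%:E <= C%:E)%E.
Proof.
move=> xy f0 cf dF FC.
(* A denominator of at least 3 makes [e n] smaller than half the length, so every [I n] is a
   nondegenerate interval. *)
pose e n : R := (y - x) / n.+3%:R.
have e0 n : 0 < e n by rewrite divr_gt0 ?subr_gt0.
have e2 n : e n < (y - x) / 2.
  by rewrite /e ltr_pM2l ?subr_gt0// ltf_pV2 ?posrE// ltr_nat.
pose I n : set (measurableTypeR R) := `[x + e n, y - e n]%classic.
have IU : \bigcup_n I n = `]x, y[%classic.
  apply/seteqP; split => [t [n _]|t]; rewrite /I /= !in_itv/=.
    by have := e0 n; move=> ? /andP[? ?]; apply/andP; split; lra.
  move=> /andP[xt ty].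
  pose del := Num.min (t - x) (y - t) / (y - x).
  have del0 : 0 < del by rewrite divr_gt0 ?subr_gt0// lt_min !subr_gt0 xt.
  have [N _ HN] := near_infty_natSinv_lt (PosNum del0).
  exists N => //; rewrite /I /= in_itv/=.
  have eN : e N < Num.min (t - x) (y - t).
    have -> : Num.min (t - x) (y - t) = (y - x) * del.
      by rewrite /del mulrC divfK// subr_eq0 gt_eqF.
    rewrite /e ltr_pM2l ?subr_gt0//; apply: le_lt_trans (HN N (leqnn N)).
    by rewrite lef_pV2 ?posrE// ler_nat -addn2 leq_addr.
  by move: eN; rewrite lt_min => /andP[? ?]; apply/andP; split; lra.
have Ixy n t : I n t -> x < t < y.
  move=> It; have : (\bigcup_n I n) t by exists n.
  by rewrite IU /= in_itv.
rewrite -IU.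
have mI n : measurable_fun (I n) (EFin \o f).
  apply/measurable_EFinP; apply: (@measurable_funS _ _ _ _ `]x, y[%classic) => //.
    by move=> t /Ixy; rewrite /= in_itv.
  exact: continuous_oo_measurable.
have ndI : {homo I : n m / (n <= m)%N >-> (n <= m)%O}.
  move=> n k nk; apply/subsetPset => t; rewrite /I /= !in_itv/= => /andP[xt ty].
  have ek : e k <= e n.
    by rewrite /e ler_pM2l ?subr_gt0// lef_pV2 ?posrE// ler_nat.
  by apply/andP; split; lra.
have cvgI := @ge0_nondecreasing_set_cvg_integral _ _ _ I (EFin \o f) leb ndI
  (fun n => measurable_itv _) mI (fun n t It => f0 t (Ixy n t It)).
rewrite -(cvg_lim _ cvgI)//; apply: lime_le; first by apply/cvg_ex; eexists; exact: cvgI.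
apply: nearW => n.
have lt_n : x + e n < y - e n by have := e2 n; lra.
have dn t : x + e n <= t <= y - e n -> x < t < y.
  by move=> ?; apply: (Ixy n); rewrite /I /= in_itv.
have cF t : x < t < y -> {for t, continuous F}.
  by move=> /dF; exact: is_derive_continuous.
rewrite (@continuous_FTC2 _ f F)//.
- rewrite -EFinB lee_fin; apply: FC; apply: dn; apply/andP; split; lra.
- apply: continuous_in_subspaceT => t; rewrite inE /= in_itv/= => /dn; exact: cf.
- split.
  + move=> t; rewrite in_itv/= => /andP[? ?].
    by have /dF dFt : x < t < y; [apply: dn; apply/andP; split; lra|exact: ex_derive].
  + apply: cvg_at_right_filter; apply: cF; apply: dn; apply/andP; split; lra.
  + apply: cvg_at_left_filter; apply: cF; apply: dn; apply/andP; split; lra.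
- move=> t; rewrite in_itv/= => /andP[? ?].
  have /dF dFt : x < t < y by apply: dn; apply/andP; split; lra.
  by rewrite derive1E; exact: derive_val.
Qed.

Lemma is_derive_powR_comp (g : R -> R) r t dg : 0 < g t ->
  is_derive t 1 g dg ->
  is_derive t 1 (fun z => g z `^ r) (r * g t `^ (r - 1) * dg).
Proof.
move=> g0 gt; apply: (is_derive1_comp (f := fun z => z `^ r)).
exact: is_derive1_powR.
Qed.

(* The integrand [t (e (t^2 - P) / k)^r] has the primitive
   [k e / (2 (r + 1)) (e (t^2 - P) / k)^(r + 1)]. *)
Lemma integral_mul_powR_le (e P k r u x y : R) : 0 < k -> e ^+ 2 = 1 -> -1 < r ->
  0 <= x -> x < y ->
  (forall t, x < t < y -> 0 < e * (t ^+ 2 - P) / k <= u) ->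
  (\int[leb]_(t in `]x, y[) (t * (e * (t ^+ 2 - P) / k) `^ r)%:E <=
    (k / (2 * (r + 1)) * u `^ (r + 1))%:E)%E.
Proof.
move=> k0 e1 r1 x0 xy hu.
pose h t := e * (t ^+ 2 - P) / k.
have dh t : is_derive t 1 h (e * (2 * t) / k).
  rewrite (_ : h = (fun t => (e / k) * (t ^+ 2 - P))); last first.
    by apply/funext => z; rewrite /h mulrAC.
  apply: is_derive_eq. rewrite /GRing.scale/=; ring.
have r10 : 0 < r + 1 by lra.
have dhr q t : x < t < y -> is_derive t 1 (fun z => h z `^ q)
    (q * h t `^ (q - 1) * (e * (2 * t) / k)).
  by move=> /hu /andP[ht _]; exact: is_derive_powR_comp.
pose F t := (k * e / (2 * (r + 1))) * h t `^ (r + 1).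
apply: (@ge0_integral_oo_le _ F) => //.
- by move=> t /andP[xt _]; rewrite mulr_ge0 ?powR_ge0// (le_trans x0)// ltW.
- move=> t txy; apply: cvgM; first exact: cvg_id.
  exact: (is_derive_continuous (dhr r t txy)).
- move=> t txy; have := dhr (r + 1) t txy => D.
  apply: is_derive_eq; rewrite /GRing.scale/= addrK -/(h t).
  have -> : k * e / (2 * (r + 1)) * ((r + 1) * h t `^ r * (e * (2 * t) / k)) =
    e ^+ 2 * (t * h t `^ r) by field; rewrite !gt_eqF.
  by rewrite e1 mul1r.
- move=> s t sxy txy.
  have hb z : x < z < y -> 0 <= h z `^ (r + 1) <= u `^ (r + 1).
    move=> /hu /andP[h0 hzu]; rewrite powR_ge0/=.
    by apply: ge0_ler_powR; rewrite ?nnegrE// ltW// (lt_le_trans h0).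
  have K0 : 0 <= k / (2 * (r + 1)) by rewrite divr_ge0 ?mulr_ge0// ltW.
  have -> : F t - F s = k / (2 * (r + 1)) * (e * (h t `^ (r + 1) - h s `^ (r + 1))).
    by rewrite /F; field; rewrite gt_eqF.
  rewrite ler_wpM2l//.
  have /andP[? ?] := hb t txy; have /andP[? ?] := hb s sxy.
  have /eqP : (e - 1) * (e + 1) = 0.
    have -> : (e - 1) * (e + 1) = e ^+ 2 - 1 by ring.
    by rewrite e1 subrr.
  by rewrite mulf_eq0 subr_eq0 addr_eq0 => /orP[] /eqP ->; lra.
Qed.

(* [0] where [r <= 0], since [0 `^ (- 2^-1) = 0]. *)
Definition invsqrt r := Num.max r 0 `^ (- 2^-1).

Lemma invsqrt_le0 r : r <= 0 -> invsqrt r = 0.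
Proof.
by move=> r0; rewrite /invsqrt (max_idPr r0) powR0// oppr_eq0 invr_eq0 pnatr_eq0.
Qed.

Lemma invsqrt_ge0 r : 0 <= invsqrt r.
Proof. exact: powR_ge0. Qed.

Lemma measurable_invsqrt : measurable_fun setT invsqrt.
Proof.
apply: (measurableT_comp (measurable_powR (- 2^-1))).
exact: measurable_maxr.
Qed.

(** The primitive asin (y / sqrt s) increases by at most pi, whatever the value of [s]. *)
Lemma integral_invsqrt_le s : (\int[leb]_y (invsqrt (s - y ^+ 2))%:E <= pi%:E)%E.
Proof.
have [s0|s0] := leP s 0.
  rewrite integral0_eq ?lee_fin ?pi_ge0// => y _.
  by rewrite invsqrt_le0// lerBlDr (le_trans s0)// add0r sqr_ge0.
have q0 : 0 < Num.sqrt s by rewrite sqrtr_gt0.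
have sq : Num.sqrt s ^+ 2 = s by rewrite sqr_sqrtr// ltW.
have pos y : - Num.sqrt s < y < Num.sqrt s -> 0 < s - y ^+ 2.
  by move=> /andP[? ?]; rewrite -sq; nra.
rewrite (_ : \int[leb]_y _ = \int[leb]_(y in `](- Num.sqrt s)%R, Num.sqrt s[)
    ((s - y ^+ 2) `^ (- 2^-1))%:E)%E; last first.
  rewrite [RHS]integral_mkcond; apply: eq_integral => y _; rewrite patchE.
  case: ifPn => [|]; rewrite ?inE ?notin_setE /= in_itv/=.
    by move=> /pos yI; rewrite /invsqrt (max_idPl _)// ltW.
  move=> /negP yI.
  rewrite invsqrt_le0// subr_le0 -sq -[leRHS]real_normK ?num_real//.
  by rewrite lerXn2r ?nnegrE ?sqrtr_ge0// leNgt ltr_norml.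
have itv1 y : - Num.sqrt s < y < Num.sqrt s -> -1 < y / Num.sqrt s < 1.
  move=> /andP[? ?]; rewrite ltr_pdivlMr// ltr_pdivrMr// mulN1r mul1r.
  by apply/andP; split.
have D y : - Num.sqrt s < y < Num.sqrt s ->
    is_derive y 1 (fun z => asin (z / Num.sqrt s)) ((s - y ^+ 2) `^ (- 2^-1)).
  move=> yI; have dy : is_derive y 1 (fun z => z / Num.sqrt s) (Num.sqrt s)^-1.
    by apply: is_derive_eq; rewrite /GRing.scale/=; ring.
  have := is_derive1_comp (f := asin) (g := fun z => z / Num.sqrt s) (is_derive1_asin (itv1 y yI)) dy.
  congr is_derive.
  rewrite powRN powR12_sqrt ?ltW ?pos//.
  rewrite -invfM -sqrtrM; last first.
    rewrite subr_ge0 -[leRHS](expr1n _ 2) -[leLHS]real_normK ?num_real//.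
    by rewrite lerXn2r ?nnegrE// ler_norml; have /andP[? ?] := itv1 y yI; rewrite !ltW.
  congr (_^-1); congr Num.sqrt.
  by rewrite expr_div_n sq; field; rewrite gt_eqF.
apply: (@ge0_integral_oo_le _ (fun z => asin (z / Num.sqrt s))) => //.
- by lra.
- by move=> *; exact: powR_ge0.
- move=> y yI.
  have dh : is_derive y 1 (fun z : R => s - z ^+ 2) (- (2 * y)).
    by apply: is_derive_eq; rewrite /GRing.scale/=; ring.
  exact: (is_derive_continuous (is_derive_powR_comp (g := fun z : R => s - z ^+ 2) (- 2^-1) (pos y yI) dh)).
- move=> a b aI bI.
  have bnd z : - Num.sqrt s < z < Num.sqrt s ->
      - (pi / 2) <= asin (z / Num.sqrt s) <= pi / 2.
    move=> /itv1 /andP[z1 z2].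
    by rewrite asin_geNpi2 ?asin_lepi2// !ltW.
  by have /andP[? ?] := bnd a aI; have /andP[? ?] := bnd b bI; lra.
Qed.

End improper_integrals.

(** * Integrability of the weight *)

Section weight.
Context {R : realType}.
Local Notation leb := (@lebesgue_measure R).

Lemma tint_ge0 n (F : n.-tuple R -> \bar R) :
  (forall v, 0 <= F v)%E -> (0 <= tint F)%E.
Proof.
elim: n F => [|n IH] F F0 //=.
by apply: integral_ge0 => y _; exact: IH.
Qed.

Lemma norm2_cons n (y : R) (v : n.-tuple R) :
  norm2 (cons_tuple y v) = y ^+ 2 + norm2 v.
Proof.
rewrite /norm2 big_ord_recl tnth0; congr (_ + _).
by apply: eq_bigr => i _; rewrite tnthS.
Qed.

Lemma norm2_ge0 n (v : n.-tuple R) : 0 <= norm2 v.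
Proof. by apply: sumr_ge0 => i _; exact: sqr_ge0. Qed.

Lemma measurable_norm2 n : measurable_fun setT (@norm2 R n).
Proof.
by apply: measurable_sum => i; apply: measurable_funX; exact: measurable_tnth.
Qed.

(** The arcsine integral settles one coordinate. A further coordinate y replaces [s] by s - y^2 <= 1
    and contributes only for |y| <= 1, hence a factor 2; uniformity in [s] carries the induction. *)
Lemma tint_invsqrt_le n : exists C : R, forall s, s <= 1 ->
  (tint (fun v : n.+1.-tuple R => (invsqrt (s - norm2 v))%:E) <= C%:E)%E.
Proof.
elim: n => [|n [C IH]].
  exists pi => s _ /=; apply: le_trans (integral_invsqrt_le s).
  rewrite le_eqVlt; apply/orP; left; apply/eqP; apply: eq_integral => y _.
  by rewrite norm2_cons /norm2 big_ord0 addr0.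
exists (C * 2) => s s1.
have C0 : 0 <= C.
  rewrite -lee_fin; apply: le_trans (IH 1 (lexx _)).
  by apply: tint_ge0 => v; rewrite lee_fin invsqrt_ge0.
set G := fun y : R => tint (fun v : n.+1.-tuple R =>
  (invsqrt (s - norm2 (cons_tuple y v)))%:E).
have GE y : G y = tint (fun v : n.+1.-tuple R => (invsqrt (s - y ^+ 2 - norm2 v))%:E).
  by congr tint; apply/funext => v; rewrite norm2_cons opprD addrA.
have mG : measurable_fun setT G.
  apply: (@measurable_tint _ n.+1 _ R (fun z : R * n.+1.-tuple R =>
    (invsqrt (s - norm2 (cons_tuple z.1 z.2)))%:E)).
  apply/measurable_EFinP; apply: (measurableT_comp measurable_invsqrt).
  apply: measurable_funB => //; apply: (measurableT_comp (@measurable_norm2 _)).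
  exact: measurable_cons_tuple.
have m1 : measurable_fun setT (cst C%:E \_ `[-1 : R, 1]).
  by apply/(measurable_restrictT _ _).1.
rewrite -[tint _]/(\int[leb]_y G y)%E.
apply: (@le_trans _ _ (\int[leb]_y (cst C%:E \_ `[(-1)%R, 1%R]) y)%E).
  apply: ge0_le_integral => //.
  - by move=> y _; apply: tint_ge0 => v; rewrite lee_fin invsqrt_ge0.
  - move=> y _; rewrite patchE; case: ifPn => [_|].
      by rewrite GE; apply: IH; rewrite lerBlDr (le_trans s1)// lerDl sqr_ge0.
    (* For |y| > 1 one has s - y^2 < 0, so [invsqrt] vanishes identically. *)
    rewrite notin_setE/= in_itv/= -ler_norml => /negP; rewrite -ltNge => y1.
    have y2 : 1 < y ^+ 2.
      by rewrite -real_normK ?num_real// exprn_egt1.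
    rewrite GE tint_ge0E; first 2 last.
    + by move=> v; rewrite lee_fin invsqrt_ge0.
    + rewrite integral0_eq// => v _; rewrite invsqrt_le0//.
      have := norm2_ge0 v; lra.
    + apply/measurable_EFinP; apply: (measurableT_comp measurable_invsqrt).
      by apply: measurable_funB => //; exact: measurable_norm2.
rewrite -integral_mkcond integral_cst//= lebesgue_measure_itv/= lte_fin ifT; last by lra.
by rewrite -EFinB -EFinM lee_fin opprK.
Qed.

(** * The weight and its integrals over the fibres *)

Variables (d : nat) (a b c beta gamma : R).
Hypotheses (a0 : 0 <= a) (ab : a < b) (c0 : 0 <= c) (beta0 : 0 <= beta)
  (gamma1 : -1 < gamma).
Local Notation W := (weightW a b c beta gamma).

Lemma ler_powR_npos (x y r : R) : r <= 0 -> 0 < x -> x <= y -> y `^ r <= x `^ r.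
Proof.
move=> r0 x0 xy; have y0 := lt_le_trans x0 xy.
rewrite -(opprK r) !(powRN _ (- r)) lef_pV2 ?posrE ?powR_gt0//.
by apply: ge0_ler_powR; rewrite ?nnegrE ?oppr_ge0// ltW.
Qed.

Lemma weightW_ge0 (z : pt R d) : 0 <= W z.
Proof. by rewrite /weightW !mulr_ge0 ?powR_ge0. Qed.

Lemma domL_itv (x : d.-tuple R) :
  [set t | domL a b c (x, t)] `<=`
  `[Num.sqrt (a * (1 - norm2 x) + c * norm2 x),
    Num.sqrt (b * (1 - norm2 x) + c * norm2 x)].
Proof.
move=> t [[/= x1 [At tB]] t0].
have nx := norm2_ge0 x.
set rho := 1 - norm2 x; have r0 : 0 <= rho by rewrite subr_ge0.
have A0 : 0 <= a * rho + c * norm2 x by rewrite addr_ge0 ?mulr_ge0.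
have b0 : 0 <= b by rewrite (le_trans a0)// ltW.
have B0 : 0 <= b * rho + c * norm2 x by rewrite addr_ge0 ?mulr_ge0.
have tt : Num.sqrt (t ^+ 2) = t by rewrite sqrtr_sqr ger0_norm.
rewrite in_itv/= -[X in _ <= X <= _]tt.
by rewrite !ler_sqrt ?sqr_ge0//; rewrite /rho; apply/andP; split; lra.
Qed.

Lemma measurable_ler_set d1 (T : measurableType d1) (f g : T -> R) :
  measurable_fun setT f -> measurable_fun setT g ->
  measurable [set z | f z <= g z].
Proof.
move=> mf mg; rewrite (_ : [set _ | _] = setT `&` (fun z => f z <= g z) @^-1` [set true]).
  exact: measurable_fun_ler.
by apply/seteqP; split => z /=; [move=> ?; split|case].
Qed.

Lemma measurable_norm2_fst : measurable_fun setT (fun z : pt R d => norm2 z.1).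
Proof. exact: (measurableT_comp (@measurable_norm2 _) measurable_fst). Qed.

Lemma measurable_domX : measurable [set z : pt R d | domX a b c z].
Proof.
have mn := measurable_norm2_fst.
have mt : measurable_fun setT (fun z : pt R d => z.2 ^+ 2).
  by apply: measurable_funX; exact: measurable_snd.
apply: measurableI; first exact: measurable_ler_set.
by apply: measurableI; apply: measurable_ler_set => //;
  apply: measurable_funD => //; apply: measurable_funM.
Qed.

Lemma measurable_domL : measurable [set z : pt R d | domL a b c z].
Proof.
apply: measurableI; first exact: measurable_domX.
by apply: measurable_ler_set => //; exact: measurable_snd.
Qed.

Lemma measurable_weightW : measurable_fun setT (W : pt R d -> R).
Proof.
have mn := measurable_norm2_fst.
have mt : measurable_fun setT (fun z : pt R d => z.2 ^+ 2).
  by apply: measurable_funX; exact: measurable_snd.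
apply: measurable_funM; [apply: measurable_funM|].
- by apply: measurableT_comp => //; exact: measurable_snd.
- apply: (measurableT_comp (measurable_powR _)); apply: measurable_funM => //.
  by apply: measurable_funD => //; apply: measurable_funD => //; apply: measurable_funM.
- apply: (measurableT_comp (measurable_powR _)); apply: measurable_funM => //.
  by apply: measurable_funB => //; apply: measurable_funB => //; apply: measurable_funM.
Qed.

(** As u and v are at most rho <= 1, lowering their exponents to -1/2 and [q] only increases the
    integrand. Since u + v = rho, one of them is at least rho / 2; its power is bounded by that of
    rho / 2, and t times the power of the other has an explicit primitive. *)
Lemma integral_weight_section_le : exists K : R, forall x : d.-tuple R,
  (\int[leb]_(t in [set t | domL a b c (x, t)]) (W (x, t))%:E <=
    K%:E * (invsqrt (1 - norm2 x))%:E)%E.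
Proof.
(* A negative exponent, so that v^q <= (rho / 2)^q where v >= rho / 2, yet above -1, so that t v^q
   stays integrable. *)
pose q := Num.min gamma (- 2^-1).
have q1 : -1 < q by rewrite lt_min gamma1/=; lra.
have qh : q <= - 2^-1 by rewrite ge_min lexx orbT.
(* The two summands correspond to v >= rho / 2 and to u >= rho / 2. *)
pose K := (b - a) * (2^-1 `^ q + 2^-1 `^ (- 2^-1) / (2 * (q + 1))).
exists K => x.
have nx := norm2_ge0 x.
set rho := 1 - norm2 x.
have W0 t : (0 <= (W (x, t))%:E)%E by rewrite lee_fin weightW_ge0.
have mW : measurable_fun setT (fun t => (W (x, t))%:E).
  apply/measurable_EFinP; exact: (measurableT_comp measurable_weightW (measurable_pair1 x)).
have mfib : measurable [set t | domL a b c (x, t)].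
  have := measurable_xsection x measurable_domL.
  by congr measurable; apply/seteqP; split => t; rewrite /xsection/= inE.
(* On or outside the unit sphere the fibre contains at most one point and the integral is 0. *)
have [r0|r0] := leP rho 0.
  apply: (@le_trans _ _ 0%E); last first.
    by rewrite invsqrt_le0// mule0.
  apply: (@le_trans _ _ (\int[leb]_(t in [set Num.sqrt (c * norm2 x)]) (W (x, t))%:E)%E).
    apply: ge0_subset_integral => //; first exact: measurable_funTS.
    move=> t xt; have [[/= x1 _] _] := xt; have := domL_itv xt; rewrite -/rho.
    have -> : rho = 0 by apply/eqP; rewrite eq_le r0 subr_ge0.
    by rewrite !mulr0 !add0r /= in_itv/= -eq_le eq_sym => /eqP.
  by rewrite integral_set1.
have r1 : rho <= 1 by rewrite lerBlDr lerDl.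
set A := a * rho + c * norm2 x; set B := b * rho + c * norm2 x.
have A0 : 0 <= A by rewrite addr_ge0 ?mulr_ge0// ltW.
have k0 : 0 < b - a by rewrite subr_gt0.
have BA : B - A = (b - a) * rho by rewrite /A /B; ring.
have AB : A < B by rewrite -subr_gt0 BA mulr_gt0.
have sAB : Num.sqrt A < Num.sqrt B by rewrite ltr_sqrt// (le_lt_trans A0).
pose u t := 1 * (t ^+ 2 - A) / (b - a).
pose v t := (-1) * (t ^+ 2 - B) / (b - a).
have uv t : u t + v t = rho.
  have -> : u t + v t = (B - A) / (b - a) by rewrite /u /v; field; rewrite gt_eqF.
  by rewrite BA mulrC mulKf// gt_eqF.
have uv0 t : Num.sqrt A < t < Num.sqrt B -> (0 < u t) && (0 < v t).
  move=> /andP[At tB]; have t0 : 0 < t := le_lt_trans (sqrtr_ge0 _) At.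
  apply/andP; split.
    rewrite /u divr_gt0// mul1r subr_gt0.
    by rewrite -(sqr_sqrtr A0) ltr_pXn2r ?nnegrE ?sqrtr_ge0// ltW.
  rewrite /v divr_gt0// mulN1r opprB subr_gt0.
  rewrite -(sqr_sqrtr (ltW (le_lt_trans A0 AB))) ltr_pXn2r ?nnegrE ?sqrtr_ge0//.
  exact: ltW.
pose c1 := (rho / 2) `^ q; pose c2 := (rho / 2) `^ (- 2^-1).
pose f1 t := t * u t `^ (- 2^-1); pose f2 t := t * v t `^ q.
have Wle t : Num.sqrt A < t < Num.sqrt B -> W (x, t) <= c1 * f1 t + c2 * f2 t.
  move=> tAB; have /andP[u0 v0] := uv0 t tAB.
  have /andP[At _] := tAB; have t0 : 0 < t := le_lt_trans (sqrtr_ge0 _) At.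
  have -> : W (x, t) = t * (u t `^ (beta - 2^-1) * v t `^ gamma).
    rewrite /weightW /= gtr0_norm// -mulrA; congr (_ * (_ `^ _ * _ `^ _)).
      by rewrite /u /A /rho; congr (_ / _); ring.
    by rewrite /v /B /rho; congr (_ / _); ring.
  have -> : c1 * f1 t + c2 * f2 t = t * (c1 * u t `^ (- 2^-1) + c2 * v t `^ q).
    by rewrite /f1 /f2; ring.
  rewrite ler_wpM2l ?(ltW t0)//.
  have u1 : u t <= 1 by rewrite (le_trans _ r1)// -(uv t) lerDl ltW.
  have v1 : v t <= 1 by rewrite (le_trans _ r1)// -(uv t) lerDr ltW.
  apply: (@le_trans _ _ (u t `^ (- 2^-1) * v t `^ q)).
    apply: ler_pM; rewrite ?powR_ge0//.
      by apply: ger_powR; rewrite ?u0// lerDr.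
    by apply: ger_powR; rewrite ?v0// ge_min lexx.
  have h0 : 0 < rho / 2 by rewrite divr_gt0.
  have [vr|vr] := leP (rho / 2) (v t).
    rewrite ler_wpDr ?mulr_ge0 ?powR_ge0// [leRHS]mulrC ler_wpM2l ?powR_ge0//.
    by apply: ler_powR_npos => //; rewrite (le_trans qh)// oppr_le0.
  have ur : rho / 2 <= u t by have := uv t; lra.
  rewrite ler_wpDl ?mulr_ge0 ?powR_ge0// ler_wpM2r ?powR_ge0//.
  by apply: ler_powR_npos => //; rewrite oppr_le0.
have mf1 : measurable_fun setT (EFin \o f1).
  apply/measurable_EFinP; apply: measurable_funM => //.
  apply: (measurableT_comp (measurable_powR _)).
  by apply: measurable_funM => //; apply: measurable_funM => //; apply: measurable_funB.
have mf2 : measurable_fun setT (EFin \o f2).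
  apply/measurable_EFinP; apply: measurable_funM => //.
  apply: (measurableT_comp (measurable_powR _)).
  by apply: measurable_funM => //; apply: measurable_funM => //; apply: measurable_funB.
have f10 t : Num.sqrt A < t < Num.sqrt B -> (0 <= (f1 t)%:E)%E.
  by move=> /andP[At _]; rewrite lee_fin mulr_ge0 ?powR_ge0// (le_trans (sqrtr_ge0 A))// ltW.
have f20 t : Num.sqrt A < t < Num.sqrt B -> (0 <= (f2 t)%:E)%E.
  by move=> /andP[At _]; rewrite lee_fin mulr_ge0 ?powR_ge0// (le_trans (sqrtr_ge0 A))// ltW.
apply: (@le_trans _ _ (\int[leb]_(t in `[Num.sqrt A, Num.sqrt B]) (W (x, t))%:E)%E).
  by apply: ge0_subset_integral => //; [exact: measurable_funTS|exact: domL_itv].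
rewrite integral_itv_bndoo; last exact: measurable_funTS.
apply: (@le_trans _ _ (\int[leb]_(t in `]Num.sqrt A, Num.sqrt B[)
    (c1%:E * (f1 t)%:E + c2%:E * (f2 t)%:E))%E).
  apply: ge0_le_integral => //.
  - exact: measurable_funTS.
  - by apply: measurable_funTS; apply: emeasurable_funD; apply: emeasurable_funM.
set I := `]Num.sqrt A, Num.sqrt B[%classic.
have io t : I t -> Num.sqrt A < t < Num.sqrt B by rewrite /I /= in_itv.
have If1 t : I t -> (0 <= (f1 t)%:E)%E by move=> /io; exact: f10.
have If2 t : I t -> (0 <= (f2 t)%:E)%E by move=> /io; exact: f20.
have mI (k : R) (f : R -> R) : measurable_fun setT (EFin \o f) ->
    measurable_fun I (fun t => k%:E * (f t)%:E)%E.
  by move=> mf; apply: measurable_funTS; exact: emeasurable_funM.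
have c1f1 t : I t -> (0 <= c1%:E * (f1 t)%:E)%E.
  by move=> /If1 ?; rewrite mule_ge0// lee_fin powR_ge0.
have c2f2 t : I t -> (0 <= c2%:E * (f2 t)%:E)%E.
  by move=> /If2 ?; rewrite mule_ge0// lee_fin powR_ge0.
have mI1 := mI c1 f1 mf1; have mI2 := mI c2 f2 mf2.
have mf1I : measurable_fun I (EFin \o f1) by exact: measurable_funTS.
have mf2I : measurable_fun I (EFin \o f2) by exact: measurable_funTS.
rewrite ge0_integralD;
  [|exact: measurable_itv|exact: c1f1|exact: mI1|exact: c2f2|exact: mI2].
rewrite ge0_integralZl_EFin;
  [|exact: measurable_itv|exact: If1|exact: mf1I|exact: powR_ge0].
rewrite ge0_integralZl_EFin;
  [|exact: measurable_itv|exact: If2|exact: mf2I|exact: powR_ge0].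
have I1 := @integral_mul_powR_le R 1 A (b - a) (- 2^-1) rho _ _ k0 (expr1n _ _)
  ltac:(lra) (sqrtr_ge0 A) sAB.
have m11 : (-1 : R) ^+ 2 = 1 by rewrite sqrrN expr1n.
have I2 := @integral_mul_powR_le R (-1) B (b - a) q rho _ _ k0 m11
  q1 (sqrtr_ge0 A) sAB.
apply: (@le_trans _ _ (c1%:E * ((b - a) / (2 * (- 2^-1 + 1)) * rho `^ (- 2^-1 + 1))%:E +
   c2%:E * ((b - a) / (2 * (q + 1)) * rho `^ (q + 1))%:E)%E).
  apply: leeD; apply: lee_wpmul2l; rewrite ?lee_fin ?powR_ge0//.
    by apply: I1 => t /uv0 /andP[u0 v0]; rewrite -/(u t) u0/= -(uv t) lerDl ltW.
  by apply: I2 => t /uv0 /andP[u0 v0]; rewrite -/(v t) v0/= -(uv t) lerDr ltW.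
rewrite -!EFinM -EFinD lee_fin /invsqrt (max_idPl (ltW r0)).
have rn : rho != 0 by rewrite gt_eqF.
have rD r s : rho `^ (r + s) = rho `^ r * rho `^ s by rewrite powRD// rn implybT.
(* Both terms of the bound carry the power rho^(q + 1/2); here q > -1 and rho <= 1. *)
have rle : rho `^ (q + 2^-1) <= rho `^ (- 2^-1).
  by apply: ger_powR; [rewrite r0|lra].
have E1 : rho `^ q * rho `^ 2^-1 = rho `^ (q + 2^-1) by rewrite rD.
have E2 : rho `^ (- 2^-1) * rho `^ (q + 1) = rho `^ (q + 2^-1).
  by rewrite -rD; congr (_ `^ _); field.
rewrite /c1 /c2 !powRM ?(ltW r0)// (_ : (- 2^-1 + 1 : R) = 2^-1); last by field.
have q10 : 0 < q + 1 by rewrite -ltrBlDr sub0r.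
set X := rho `^ (q + 2^-1) in rle E1 E2.
apply: (@le_trans _ _ (K * X)); last first.
  rewrite ler_wpM2l// /K mulr_ge0 ?(ltW k0)// addr_ge0 ?powR_ge0//.
  by rewrite divr_ge0 ?powR_ge0// mulr_ge0// ltW.
rewrite le_eqVlt; apply/orP; left; apply/eqP.
transitivity ((b - a) * (2^-1 `^ q * (rho `^ q * rho `^ 2^-1)
    + 2^-1 `^ (- 2^-1) / (2 * (q + 1)) * (rho `^ (- 2^-1) * rho `^ (q + 1)))).
  by field; rewrite gt_eqF.
by rewrite E1 E2 /K; ring.
Qed.

End weight.

(** * Reflection in t *)

Section reflection.
Context {R : realType}.
Local Notation leb := (@lebesgue_measure R).

Lemma ge0_integralN (A : set R) (g : R -> \bar R) : measurable A ->
  measurable_fun setT g -> (forall t, 0 <= g t)%E ->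
  (\int[leb]_(t in A) g t = \int[leb]_(t in [set t | A (- t)%R]) g (- t)%R)%E.
Proof.
move=> mA mg g0.
apply: etrans (@ge0_integral_pushforward _ _ _ _ R
  (-%R : measurableTypeR R -> measurableTypeR R) (@oppr_measurable R setT) leb A g
  mA (measurable_funTS mg) (fun y _ => g0 y)).
apply: eq_measure_integral => //= B mB _.
by apply/esym/lebesgue_measureN.
Qed.

Lemma ge0_integral_symmetric (A : set R) (g : R -> \bar R) : measurable A ->
  (forall t, A t -> A (- t)) -> measurable_fun setT g -> (forall t, 0 <= g t)%E ->
  (\int[leb]_(t in A) g t =
   \int[leb]_(t in A `&` [set t | (0 <= t)%R]) (g t + g (- t)%R))%E.
Proof.
move=> mA symA mg g0.
have mgN : measurable_fun setT (fun t : R => g (- t)%R).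
  by apply: (measurableT_comp mg); exact: oppr_measurable.
have mpos : measurable [set t : R | 0 <= t] by rewrite -set_itvcy.
have mneg : measurable [set t : R | t < 0] by rewrite -set_itvNyo.
have mP : measurable (A `&` [set t | 0 <= t]) by exact: measurableI.
have mN : measurable (A `&` [set t | t < 0]) by exact: measurableI.
rewrite ge0_integralD//; [|exact: measurable_funTS|exact: measurable_funTS].
rewrite [in LHS](_ : A = (A `&` [set t | 0 <= t]) `|` (A `&` [set t | t < 0])); last first.
  rewrite -setIUr (_ : _ `|` _ = setT) ?setIT//.
  by apply/seteqP; split => t //= _; case: (leP 0 t) => _; [left|right].
rewrite ge0_integral_setU//; first last.
- by rewrite /disj_set; apply/eqP/seteqP; split => t //= [[_ ?] [_]]; rewrite ltNge => /negP.
- exact: measurable_funTS.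
congr (_ + _)%E; rewrite ge0_integralN//.
(* The reflection of the part t < 0 misses the point t = 0, which is a null set. *)
have -> : A `&` [set t | 0 <= t] =
    [set t | (A `&` [set t | t < 0]) (- t)] `|` (A `&` [set 0]).
  apply/seteqP; split => t /=.
    move=> [At]; rewrite le_eqVlt => /orP[/eqP t0|t0]; first by right.
    by left; rewrite oppr_lt0; split => //; exact: symA.
  move=> [[/symA]|[At t0]]; last by split=> //; rewrite t0 lexx.
  by rewrite opprK oppr_lt0 => At /ltW.
rewrite ge0_integral_setU//; first last.
- rewrite /disj_set; apply/eqP/seteqP; split => t //= [[_ +] [_ t0]].
  by rewrite t0 oppr0 ltxx.
- exact: measurable_funTS.
- exact: measurableI.
- rewrite (_ : [set t | _] = setT `&` (-%R @^-1` (A `&` [set t | t < 0]))).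
    exact: oppr_measurable.
  by rewrite setTI.
rewrite [X in (_ = _ + X)%E](_ : _ = 0%E) ?adde0//.
apply: null_set_integral => //.
- exact: measurableI.
- exact: measurable_funTS.
- apply/eqP; rewrite eq_le measure_ge0 andbT -(lebesgue_measure_set1 (0 : R)).
  by apply: le_measure; rewrite ?inE//; exact: measurableI.
Qed.

End reflection.

(** * The integrals [integ] as integrals for a product measure *)

Section iterated.
Context {R : realType} {d : nat}.
Local Notation leb := (@lebesgue_measure R).
Local Notation lam := (@tuple_lebesgue R d \x leb)%E.

Lemma integ_mkcond (E : set (pt R d)) (g : pt R d -> R) :
  integ E g = tint (fun x => \int[leb]_t (g (x, t) * \1_E (x, t))%:E)%E.
Proof.
congr tint; apply/funext => x; rewrite integral_mkcond; apply: eq_integral => t _.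
rewrite patchE indicE.
have -> : (t \in [set t | E (x, t)]) = ((x, t) \in E) by apply/idP/idP; rewrite !inE.
by case: ifPn => _; rewrite ?mulr1 ?mulr0.
Qed.

Lemma integ_ge0E (E : set (pt R d)) (g : pt R d -> R) : measurable E ->
  measurable_fun setT g -> (forall z, 0 <= g z) ->
  integ E g = (\int[lam]_z (g z * \1_E z)%:E)%E.
Proof.
move=> mE mg g0.
have mF : measurable_fun setT (fun z : d.-tuple R * measurableTypeR R => (g z * \1_E z)%:E).
  by apply/measurable_EFinP; apply: measurable_funM => //; exact: measurable_indic.
have F0 z : (0 <= (g z * \1_E z)%:E)%E by rewrite lee_fin mulr_ge0.
rewrite integ_mkcond tint_ge0E; first last.
- by move=> x; apply: integral_ge0 => t _; exact: F0.
- exact: (measurable_integral_section leb mF).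
by rewrite fubini_tonelli1.
Qed.

Lemma integ_integrableE (E : set (pt R d)) (g : pt R d -> R) :
  lam.-integrable setT (fun z => (g z * \1_E z)%:E) ->
  integ E g = (\int[lam]_z (g z * \1_E z)%:E)%E.
Proof.
move=> ig; rewrite integ_mkcond tint_integrableE.
  exact: (integral12_prod_meas1 ig).
exact: (integrable_fubini_F ig).
Qed.

End iterated.

(** * The orthogonal expansion *)

Section completeness.
Context {R : realType} {d : nat}.
Variables (a b c beta gamma : R).
Hypotheses (d1 : (1 <= d)%N) (a0 : 0 <= a) (ab : a < b) (c0 : 0 <= c)
  (beta0 : 0 <= beta) (gamma1 : -1 < gamma).
Local Notation leb := (@lebesgue_measure R).
Local Notation lam := (@tuple_lebesgue R d \x leb)%E.
Local Notation W := (@weightW R d a b c beta gamma).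
Local Notation X := (@domX R d a b c).
Local Notation L := (@domL R d a b c).
Implicit Types (p q : pt R d -> R).

(** Cutting the weight off outside [L] turns L^2(W, Lambda) into a weighted space over the whole
    product. *)
Definition wL : pt R d -> R := fun z => W z * \1_L z.

Definition refl_t p : pt R d -> R := fun z => p (z.1, - z.2).

Lemma wL_ge0 z : 0 <= wL z.
Proof. by rewrite mulr_ge0 ?weightW_ge0. Qed.

(* The product carrying [lam]: the library declares Lebesgue measure on
   [measurableTypeR R], whose display differs from the default one of [R]. *)
Lemma measurable_wL :
  measurable_fun [set: d.-tuple R * measurableTypeR R] wL.
Proof.
apply: measurable_funM; first exact: measurable_weightW.
by apply: measurable_indic; exact: measurable_domL.
Qed.

Lemma wL_out z : ~ L z -> wL z = 0.
Proof. by move=> Lz; rewrite /wL indicE memNset ?mulr0. Qed.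

Lemma integrable_wL : lam.-integrable setT (EFin \o wL).
Proof.
apply/integrableP; split; first by apply/measurable_EFinP; exact: measurable_wL.
under eq_integral do rewrite /= ger0_norm ?wL_ge0//.
have mw : measurable_fun setT (fun z : d.-tuple R * measurableTypeR R => (wL z)%:E).
  by apply/measurable_EFinP; exact: measurable_wL.
rewrite fubini_tonelli1//; last by move=> z; rewrite lee_fin wL_ge0.
have [K HK] := @integral_weight_section_le R d a b c beta gamma a0 ab c0 beta0 gamma1.
have minv : measurable_fun setT (fun x : d.-tuple R => (invsqrt (1 - norm2 x))%:E).
  apply/measurable_EFinP; apply: (measurableT_comp measurable_invsqrt).
  by apply: measurable_funB => //; exact: measurable_norm2.
(* [K] comes without a sign; its absolute value can be taken out of an integral of nonnegative
   functions. *)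
apply: (@le_lt_trans _ _ (\int[tuple_lebesgue d]_x
    (`|K|%:E * (invsqrt (1 - norm2 x))%:E))%E).
  apply: ge0_le_integral => //.
  - by move=> x _; apply: integral_ge0 => t _; rewrite lee_fin wL_ge0.
  - exact: (measurable_integral_section leb mw).
  - exact: emeasurable_funM.
  - move=> x _.
    apply: (@le_trans _ _ (\int[leb]_(t in [set t | L (x, t)]) (W (x, t))%:E)%E).
      rewrite le_eqVlt; apply/orP; left; apply/eqP.
      rewrite [RHS]integral_mkcond; apply: eq_integral => t _.
      rewrite patchE /wL indicE.
      have -> : (t \in [set t | L (x, t)]) = ((x, t) \in L) by apply/idP/idP; rewrite !inE.
      by case: ifPn => _; rewrite ?mulr1 ?mulr0.
    apply: le_trans (HK x) _; rewrite -!EFinM lee_fin ler_wpM2r ?invsqrt_ge0//.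
    exact: ler_norm.
rewrite ge0_integralZl_EFin//; last by move=> x _; rewrite lee_fin invsqrt_ge0.
rewrite -tint_ge0E//; last by move=> x; rewrite lee_fin invsqrt_ge0.
rewrite lte_mul_pinfty ?lee_fin//.
(* Here d >= 1 supplies the coordinate over which rho^(-1/2) is integrated. *)
case: d d1 => // n _; have [C HC] := @tint_invsqrt_le R n.
exact: le_lt_trans (HC 1 (lexx _)) (ltry _).
Qed.

Local Notation ip := (wip lam wL).
Local Notation sq := (wsq lam wL).
Local Notation L2 := (wL2 lam wL).

Lemma coord_le1 z : X z -> forall i, `|tnth z.1 i| <= 1.
Proof.
move=> [z1 _] i; rewrite -(@ler_pXn2r _ 2) ?nnegrE//.
rewrite real_normK ?num_real// expr1n (le_trans _ z1)//.
by rewrite /norm2 (bigD1 i)//= lerDl sumr_ge0// => j _; exact: sqr_ge0.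
Qed.

Lemma abs_t_le z : X z -> `|z.2| <= a + b + c + 1.
Proof.
move=> [z1 [_ zt]]; have n0 := norm2_ge0 z.1.
have b0 : 0 <= b by rewrite (le_trans a0)// ltW.
have M0 : 0 <= a + b + c + 1 by rewrite !addr_ge0.
rewrite -(@ler_pXn2r _ 2) ?nnegrE// real_normK ?num_real// (le_trans zt)//.
(* With M = a + b + c + 1 >= 1, the chain is t^2 <= M <= M^2. *)
apply: (@le_trans _ _ (a + b + c + 1)); last first.
  by rewrite expr2 ler_peMr// lerDr !addr_ge0.
have h1 : 0 <= b * norm2 z.1 by rewrite mulr_ge0.
have h2 : 0 <= c * (1 - norm2 z.1) by rewrite mulr_ge0// subr_ge0.
rewrite (_ : b + _ = b + c - b * norm2 z.1 - c * (1 - norm2 z.1)); last by ring.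
rewrite -addrA (_ : a + b + c + 1 = b + c + (a + 1)); last by ring.
by rewrite lerD2l (@le_trans _ _ 0)// ?addr_ge0// -opprD oppr_le0 addr_ge0.
Qed.

Lemma domL_domX z : L z -> X z.
Proof. by case. Qed.

Lemma polyn_bounded_L n p : polyn n p -> exists C : R, forall z, L z -> `|p z| <= C.
Proof.
move=> /(polyn_bounded (a + b + c + 1)) [C pC]; exists C => z /domL_domX Xz.
by apply: pC; [exact: coord_le1|exact: abs_t_le].
Qed.

Lemma polyn_L2 n p : polyn n p -> L2 p.
Proof.
move=> np; have [C pC] := polyn_bounded_L np.
apply: (wL2_bounded measurable_wL wL_ge0 wL_out integrable_wL _ pC).
exact: measurable_polyn np.
Qed.

Lemma weightW_refl z : W (z.1, - z.2) = W z.
Proof. by rewrite /weightW /= normrN sqrrN. Qed.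

Lemma ipW_L p q : L2 p -> L2 q -> ipW a b c beta gamma L p q = (ip p q)%:E.
Proof.
move=> Lp Lq; rewrite -(wipE measurable_wL wL_ge0 Lp Lq) /ipW.
have E z : p z * q z * wL z = p z * q z * W z * \1_L z by rewrite /wL mulrA.
rewrite integ_integrableE; first by apply: eq_integral => z _; rewrite E.
have := integrable_wip measurable_wL wL_ge0 Lp Lq.
by under eq_fun do rewrite E.
Qed.

(** The integrand is nonnegative, so Tonelli applies; this carries the finiteness in [inL2] over to
    [wL2]. *)
Lemma ipW_L_sq p : measurable_fun setT p ->
  ipW a b c beta gamma L p p = sq p.
Proof.
move=> mp; rewrite /ipW integ_ge0E//.
- by apply: eq_integral => z _; rewrite /wL expr2 mulrA.
- exact: measurable_domL.
- by apply: measurable_funM; [exact: measurable_funM|exact: measurable_weightW].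
- by move=> z; rewrite mulr_ge0 ?weightW_ge0// -expr2 sqr_ge0.
Qed.

Lemma measurable_refl_t p : measurable_fun setT p -> measurable_fun setT (refl_t p).
Proof.
move=> mp; apply: (measurableT_comp mp).
apply: measurable_fun_pair; first exact: measurable_fst.
by apply: (measurableT_comp (@oppr_measurable R setT)); exact: measurable_snd.
Qed.

(** Each fibre of [X] is folded onto t >= 0, using that [W] is even in t. *)
Lemma ge0_integ_X p : measurable_fun setT p -> (forall z, 0 <= p z) ->
  integ X (fun z => p z * W z) = (\int[lam]_z ((p z + refl_t p z) * wL z)%:E)%E.
Proof.
move=> mp p0.
have mW := @measurable_weightW R d a b c beta gamma.
transitivity (integ L (fun z => (p z + refl_t p z) * W z)); last first.
  rewrite integ_ge0E//.
  - by apply: eq_integral => z _; rewrite /wL mulrA.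
  - exact: measurable_domL.
  - by apply: measurable_funM => //; apply: measurable_funD => //; exact: measurable_refl_t.
  - move=> z; rewrite mulr_ge0 ?weightW_ge0// addr_ge0//; exact: p0.
congr tint; apply/funext => x.
rewrite ge0_integral_symmetric.
- apply: eq_integral => t _; rewrite -EFinD /refl_t mulrDl; congr (_ + _)%:E.
  by rewrite -(weightW_refl (x, t)).
- have := measurable_xsection x (@measurable_domX R d a b c).
  by congr measurable; apply/seteqP; split => t; rewrite /xsection/= inE.
- by move=> t; rewrite /domX /= sqrrN.
- apply/measurable_EFinP.
  by apply: (measurableT_comp (measurable_funM mp mW) (measurable_pair1 x)).
- by move=> t; rewrite lee_fin mulr_ge0 ?weightW_ge0.
Qed.

(** The nonnegative case is applied to the positive and negative parts of [p], which inherit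
    integrability from [p] and its reflection. *)
Lemma integ_X p : measurable_fun setT p ->
  lam.-integrable setT (fun z => (p z * wL z)%:E) ->
  lam.-integrable setT (fun z => (refl_t p z * wL z)%:E) ->
  integ X (fun z => p z * W z) = (\int[lam]_z ((p z + refl_t p z) * wL z)%:E)%E.
Proof.
move=> mp ip_ irp.
pose pp z : R := Num.max (p z) 0; pose pn z : R := Num.max (- p z) 0.
have mpp : measurable_fun setT pp by exact: measurable_maxr.
have mpn : measurable_fun setT pn by apply: measurable_maxr => //; exact: measurable_funN.
have pE z : p z = pp z - pn z.
  by rewrite /pp /pn; case: (leP (p z) 0); case: (leP (- p z) 0); lra.
have pp0 z : 0 <= pp z by rewrite le_max lexx orbT.
have pn0 z : 0 <= pn z by rewrite le_max lexx orbT.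
have ppl z : pp z <= `|p z| by rewrite ge_max ler_norm normr_ge0.
have pnl z : pn z <= `|p z| by rewrite ge_max -normrN ler_norm normr_ge0.
have mw := measurable_wL.
have iw (g : pt R d -> R) (h : pt R d -> R) : measurable_fun setT g ->
    (forall z, 0 <= g z <= `|h z|) ->
    lam.-integrable setT (fun z => (h z * wL z)%:E) ->
    lam.-integrable setT (fun z => (g z * wL z)%:E).
  move=> mg gh; apply: le_integrable => //.
    by apply/measurable_EFinP; exact: measurable_funM.
  move=> z _; rewrite lee_fin !normrM ler_wpM2r//.
  by have /andP[g0 gl] := gh z; rewrite ger0_norm.
have isum (g : pt R d -> R) : measurable_fun setT g ->
    (forall z, 0 <= g z <= `|p z|) ->
    lam.-integrable setT (fun z => ((g z + refl_t g z) * wL z)%:E).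
  move=> mg gp.
  rewrite (_ : (fun z => _) = (fun z => (g z * wL z)%:E + (refl_t g z * wL z)%:E)%E).
    apply: integrableD => //; first exact: (iw _ _ mg gp).
    by apply: (iw _ _ (measurable_refl_t mg) _ irp) => z; exact: gp.
  by apply/funext => z; rewrite -EFinD mulrDl.
have ipp := isum pp mpp (fun z => introT andP (conj (pp0 z) (ppl z))).
have ipn := isum pn mpn (fun z => introT andP (conj (pn0 z) (pnl z))).
have mW := @measurable_weightW R d a b c beta gamma.
(* Folding also transfers integrability from [L] to [X]. *)
have iX (g : pt R d -> R) : measurable_fun setT g -> (forall z, 0 <= g z) ->
    lam.-integrable setT (fun z => ((g z + refl_t g z) * wL z)%:E) ->
    lam.-integrable setT (fun z => (g z * W z * \1_X z)%:E).
  move=> mg g0 ig; apply/integrableP; split.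
    apply/measurable_EFinP; apply: measurable_funM; first exact: measurable_funM.
    by apply: measurable_indic; exact: measurable_domX.
  have gW z : 0 <= g z * W z * \1_X z.
    by apply: mulr_ge0 => //; apply: mulr_ge0 => //; exact: weightW_ge0.
  under eq_integral do rewrite abse_EFin ger0_norm ?gW//.
  rewrite -(@integ_ge0E _ _ X (fun z => g z * W z)).
  - rewrite ge0_integ_X//; apply: integrable_lty => //.
  - exact: measurable_domX.
  - exact: measurable_funM.
  - by move=> z; rewrite mulr_ge0 ?weightW_ge0.
have Xpp := iX pp mpp pp0 ipp; have Xpn := iX pn mpn pn0 ipn.
have XE : (fun z => (p z * W z * \1_X z)%:E) =
    ((fun z => (pp z * W z * \1_X z)%:E) \- (fun z => (pn z * W z * \1_X z)%:E))%E.
  by apply/funext => z /=; rewrite -EFinB pE; congr EFin; ring.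
rewrite integ_integrableE XE; last exact: integrableB.
rewrite integralB// -!integ_ge0E; first last.
- by move=> z; rewrite mulr_ge0 ?weightW_ge0.
- exact: measurable_funM.
- exact: measurable_domX.
- by move=> z; rewrite mulr_ge0 ?weightW_ge0.
- exact: measurable_funM.
- exact: measurable_domX.
rewrite !ge0_integ_X// -integralB//.
apply: eq_integral => z _; rewrite -EFinB /refl_t !pE; congr EFin; ring.
Qed.

Lemma ipW_X p q n m : polyn n p -> polyn m q -> even_t p ->
  ipW a b c beta gamma X p q = (ip p (q \+ refl_t q))%:E.
Proof.
move=> np mq ep.
have rp : refl_t p = p by apply/funext => -[x t]; exact: ep.
have mq' : polyn m (refl_t q) by exact: polyn_reflect.
have Lp := polyn_L2 np; have Lq := polyn_L2 mq; have Lq' := polyn_L2 mq'.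
rewrite /ipW integ_X.
- rewrite -(wipE measurable_wL wL_ge0 Lp (polyn_L2 (polynD mq mq'))).
  apply: eq_integral => z _; congr (_ * _)%:E.
  have rz : p (z.1, - z.2) = p z by rewrite -[RHS](congr1 (@^~ z) rp).
  by rewrite /refl_t /= rz mulrDr.
- by apply: measurable_funM; [exact: measurable_polyn np|exact: measurable_polyn mq].
- exact: (integrable_wip measurable_wL wL_ge0 Lp Lq).
- have := integrable_wip measurable_wL wL_ge0 Lp Lq'.
  by rewrite -{1}rp.
Qed.

(** Testing against [q] on [X] amounts to testing on [L] against the even polynomial
    [q \+ refl_t q], which is 2 q when [q] is even. *)
Lemma inVEP n p : inVE a b c beta gamma n p <->
  evenpoly n p /\ forall m q, (m < n)%N -> evenpoly m q -> ip p q = 0.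
Proof.
split=> [[/is_poly_polyn np [ep orth]]|[[np ep] orth]].
  split=> // m q mn [mq eq_].
  have := orth m q mn (polyn_is_poly mq).
  rewrite (ipW_X np mq ep).
  have rq : refl_t q = q by apply/funext => -[x t]; exact: eq_.
  have Lp := polyn_L2 np; have Lq := polyn_L2 mq.
  rewrite rq wipC -[q \+ q]/(q + q) (wipD measurable_wL wL_ge0 Lq Lq Lp).
  by rewrite wipC => -[] /eqP; rewrite -mulr2n mulrn_eq0/= => /eqP.
split; [exact: polyn_is_poly|split=> // m q mn /is_poly_polyn mq].
rewrite (ipW_X np mq ep) (orth m)//; split.
  by apply: polynD => //; exact: polyn_reflect.
by move=> x t; rewrite /refl_t /= opprK addrC.
Qed.

Lemma wL_L2D (p q : pt R d -> R^o) : L2 p -> L2 q -> L2 (p + q).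
Proof. exact: (wL2D measurable_wL wL_ge0). Qed.

Lemma wL_L2Z k (p : pt R d -> R^o) : L2 p -> L2 (k *: p).
Proof. exact: (wL2Z measurable_wL wL_ge0 wL_out). Qed.

Lemma wL_ipD (p q h : pt R d -> R^o) :
  L2 p -> L2 q -> L2 h -> ip (p + q) h = ip p h + ip q h.
Proof. exact: (wipD measurable_wL wL_ge0). Qed.

Lemma wL_ipZ k (p h : pt R d -> R^o) : L2 p -> L2 h -> ip (k *: p) h = k * ip p h.
Proof. exact: (wipZ measurable_wL wL_ge0 wL_out). Qed.

Lemma wL_ip_ge0 (p : pt R d -> R^o) : L2 p -> 0 <= ip p p.
Proof. exact: (wip_ge0 measurable_wL wL_ge0). Qed.

Lemma projection_evenpoly n p : L2 p ->
  exists2 r, evenpoly n r & forall q, evenpoly n q -> ip (p - r) q = 0.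
Proof.
move=> Lp.
have LE q : evenpoly n q -> L2 q by move=> [nq _]; exact: polyn_L2 nq.
have Ls : allP L2 (evengens n) by exact: allP_imp (allP_evengens n).
have L0 : L2 0 by exact: polyn_L2 (polyn0 0).
have [r sr orth] := orthogonal_projection wL_L2D wL_L2Z (wipC lam wL) wL_ipD wL_ipZ
  wL_ip_ge0 L0 Ls Lp.
exists r => [|q nq]; first exact: span_evengens_evenpoly.
apply: (orthogonal_span wL_L2D wL_L2Z (wipC lam wL) wL_ipD wL_ipZ L0 _ Ls) orth _;
  last exact: span_seq_evengens.
rewrite -scaleN1r; apply: wL_L2D => //; apply: wL_L2Z; apply: LE.
exact: span_evengens_evenpoly.
Qed.

Lemma evenpoly_dense (f : pt R d -> R) (e : R) : L2 f -> 0 < e ->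
  exists n, exists2 q, evenpoly n q & (sq (f \- q)%R < e%:E)%E.
Proof.
move=> [mf ff] e0.
pose A (q : pt R d -> R) := exists n, evenpoly n q.
have [q [n nq] fq] : exists2 q, A q & (sq (f \- q)%R < e%:E)%E.
  apply: (@approximable_L2 _ _ R lam L wL measurable_wL wL_ge0 wL_out integrable_wL A) => //.
  - by move=> k; exists 0%N; split => //; exact: polyn_cst.
  - move=> g h [n ng] [m mh]; exists (maxn n m).
    by apply: evenpolyD; [exact: evenpoly_leq (leq_maxl _ _) ng|exact: evenpoly_leq (leq_maxr _ _) mh].
  - by move=> g h [n ng] [m mh]; exists (n + m)%N; exact: evenpolyM.
  - by move=> g [n [ng _]]; exact: measurable_polyn ng.
  - by move=> g [n [ng _]]; exact: polyn_bounded_L ng.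
  - by move=> H sH HA HD; apply: (evenpoly_generate _ sH HA HD) => z [].
by exists n, q.
Qed.

Lemma inVE_L2 n p : inVE a b c beta gamma n p -> L2 p.
Proof. by move=> /inVEP [[np _] _]; exact: polyn_L2 np. Qed.

Section expansion.
Variables (f : pt R d -> R^o) (P : nat -> pt R d -> R^o).
Hypothesis Lf : L2 f.
Hypothesis projP : forall n, is_projE a b c beta gamma n f (P n).

Let S N : pt R d -> R^o := \sum_(n < N) P n.

Let VP n : inVE a b c beta gamma n (P n). Proof. by have [] := projP n. Qed.

Let LP n : L2 (P n). Proof. exact: inVE_L2 (VP n). Qed.

Let LB (p q : pt R d -> R^o) : L2 p -> L2 q -> L2 (p - q).
Proof. by move=> Lp Lq; rewrite -scaleN1r; apply: wL_L2D => //; exact: wL_L2Z. Qed.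

Let ipB (p q h : pt R d -> R^o) :
  L2 p -> L2 q -> L2 h -> ip (p - q) h = ip p h - ip q h.
Proof. exact: (bformBl wL_L2Z wL_ipD wL_ipZ). Qed.

Let LS N : L2 (S N).
Proof.
rewrite /S; elim: N => [|N IH]; first by rewrite big_ord0; exact: polyn_L2 (polyn0 0).
by rewrite big_ord_recr; exact: wL_L2D.
Qed.

Let evenpolyP n : evenpoly n (P n).
Proof. by have /inVEP [] := VP n. Qed.

Let ipP0 n m q : (m < n)%N -> evenpoly m q -> ip (P n) q = 0.
Proof. by have /inVEP [_] := VP n; exact. Qed.

Let ipPproj n q : inVE a b c beta gamma n q -> ip (f - P n) q = 0.
Proof.
move=> Vq; have [_ /(_ _ Vq)] := projP n.
rewrite (ipW_L (LB Lf (LP n)) (inVE_L2 Vq)) => -[].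
exact.
Qed.

Let evenpolyS N : evenpoly N (S N.+1).
Proof.
rewrite /S; elim: N => [|N IH]; rewrite big_ord_recr/=.
  by rewrite big_ord0 add0r; exact: evenpolyP.
by apply: evenpolyD; [exact: evenpoly_leq IH|exact: evenpolyP].
Qed.

Lemma residual_L2 N : L2 (f - S N).
Proof. exact: LB. Qed.

(** Write q = r + (q - r) with [r] of lower degree and q - r in V^E_N. Against [r], f - S_N vanishes
    by induction and P_N by its degree; against q - r, f - P_N vanishes by projection and S_N by its
    degree. *)
Lemma partial_sum_orthogonal N m q : (m < N)%N -> evenpoly m q -> ip (f - S N) q = 0.
Proof.
elim: N m q => // N IH m q; rewrite ltnS => mN /(evenpoly_leq mN) Eq.
have Lq : L2 q by have [nq _] := Eq; exact: polyn_L2 nq.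
(* Gram-Schmidt: q is the sum of an even polynomial of lower degree and of an
   element of V^E_N. *)
have [r [Lr Vr Er]] : exists r : pt R d -> R^o, [/\ L2 r,
    inVE a b c beta gamma N (q - r) & ip (f - S N) r = 0 /\ ip (P N) r = 0].
  (* Below degree 0 there is nothing, so r = 0; otherwise [r] is the projection of [q] on the even
     polynomials of lower degree. *)
  case: N IH mN Eq => [|N] IH mN Eq.
    exists 0; split.
    - exact: polyn_L2 (polyn0 0).
    - by rewrite subr0; apply/inVEP; split.
    - have r0 (h : pt R d -> R^o) : L2 h -> ip h 0 = 0.
        move=> Lh; have := wL_ipZ 0 Lh Lh; rewrite scale0r mul0r wipC; exact.
      by rewrite !r0//; exact: LB.
  have [r Er orth] := projection_evenpoly N Lq.
  exists r; split.
  - by have [nr _] := Er; exact: polyn_L2 nr.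
  - apply/inVEP; split.
      rewrite -scaleN1r; apply: evenpolyD => //.
      by apply: evenpolyZ; exact: evenpoly_leq Er.
    by move=> k h kN Eh; apply: orth; exact: evenpoly_leq Eh.
  - by split; [exact: (IH N)|exact: (@ipP0 N.+1 N)].
have Lqr : L2 (q - r) by exact: LB.
have LfS : L2 (f - S N) by exact: LB.
have SP k : (k <= N)%N -> ip (S k) (q - r) = 0.
  elim: k => [|k IHk] kN.
    by rewrite /S big_ord0; have := wL_ipZ 0 Lqr Lqr; rewrite scale0r mul0r.
  rewrite /S big_ord_recr -/(S k) wL_ipD// IHk ?(ltnW kN)// add0r wipC.
  by have /inVEP [_ /(_ k _ kN (evenpolyP k))] := Vr.
have SE : f - S N.+1 = (f - S N) - P N by rewrite /S big_ord_recr/= opprD addrA.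
have L1 : L2 (f - S N.+1) by exact: LB.
have E1 : ip (f - S N.+1) r = 0 by rewrite SE ipB// Er.1 Er.2 subrr.
have E2 : ip (f - S N.+1) (q - r) = 0.
  by rewrite SE addrAC ipB ?SP ?ipPproj ?subrr//; exact: LB.
by rewrite -(subrK r q) (bformDr (wipC lam wL) wL_ipD)// E1 E2 addr0.
Qed.

(** Pythagoras: f - q = (f - S_N) + (S_N - q), where S_N - q is an even polynomial of degree below
    [N], hence orthogonal to the first term. *)
Lemma partial_sum_le N m q : (m < N)%N -> evenpoly m q ->
  (sq (f - S N)%R <= sq (f - q)%R)%E.
Proof.
case: N => // N; rewrite ltnS => mN Eq.
have Lq : L2 q by have [nq _] := Eq; exact: polyn_L2 nq.
have LfS : L2 (f - S N.+1) by exact: LB.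
have LSq : L2 (S N.+1 - q) by exact: LB.
rewrite !(wsqE measurable_wL wL_ge0) ?lee_fin; [|exact: LB|exact: LB].
have -> : f - q = (f - S N.+1) + (S N.+1 - q) by rewrite addrA subrK.
have orth : ip (f - S N.+1) (S N.+1 - q) = 0.
  apply: (@partial_sum_orthogonal _ N) => //.
  rewrite -scaleN1r.
  exact: (evenpolyD (evenpolyS N) (evenpolyZ (-1) (evenpoly_leq mN Eq))).
move: (f - S N.+1) (S N.+1 - q) LfS LSq orth => u v Lu Lv uv.
have Luv : L2 (u + v) by exact: wL_L2D.
rewrite wL_ipD// !(bformDr (wipC lam wL) wL_ipD)//.
by rewrite uv [ip v u]wipC uv addr0 add0r lerDl wL_ip_ge0.
Qed.

Lemma partial_sum_cvg : sq (f - S N) @[N --> \oo] --> 0%E.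
Proof.
rewrite (_ : (fun N => _) = EFin \o (fun N => ip (f - S N) (f - S N))); last first.
  by apply/funext => N; rewrite /= (wsqE measurable_wL wL_ge0)//; exact: LB.
apply: cvg_EFin; first exact: nearW.
apply/cvgrPdist_lt => e e0.
have [m [q Eq fq]] := evenpoly_dense Lf e0.
exists m.+1 => // N /= mN.
rewrite sub0r normrN ger0_norm; last by apply: wL_ip_ge0; exact: LB.
rewrite -lte_fin -(wsqE measurable_wL wL_ge0); last exact: LB.
exact: le_lt_trans (partial_sum_le mN Eq) fq.
Qed.

End expansion.

End completeness.

Theorem theorem4p8 (R : realType) (d : nat) (a b c beta gamma : R)
  (hd : (1 <= d)%N) (ha : 0 <= a) (hab : a < b) (hc : 0 <= c)
  (hbeta : 0 <= beta) (hgamma : -1 < gamma)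
  (f : pt R d -> R) (hf : inL2 a b c beta gamma f)
  (P : nat -> pt R d -> R)
  (hP : forall n, is_projE a b c beta gamma n f (P n)) :
  (fun N : nat =>
     ipW a b c beta gamma (domL a b c)
       (fun p => f p - \sum_(n < N) P n p)
       (fun p => f p - \sum_(n < N) P n p)) @ \oo --> 0%E.
Proof.
have [mf ff] := hf.
have Lf : wL2 (tuple_lebesgue d \x @lebesgue_measure R)%E (wL a b c beta gamma) f.
  by split => //; rewrite -ipW_L_sq.
(* The pointwise residual is the residual in the vector space of functions. *)
have resE N : (fun p => f p - \sum_(n < N) P n p) =
    ((f : pt R d -> R^o) - \sum_(n < N) (P n : pt R d -> R^o)) :> (pt R d -> R^o).
  by apply/funext => p; rewrite -[RHS]/(f p - (\sum_(n < N) (P n : pt R d -> R^o)) p) fct_sumE.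
rewrite (_ : (fun N => _) = (fun N => wsq (tuple_lebesgue d \x @lebesgue_measure R)%E
    (wL a b c beta gamma) ((f : pt R d -> R^o) - \sum_(n < N) (P n : pt R d -> R^o))%R)).
  exact: (partial_sum_cvg hd ha hab hc hbeta hgamma Lf hP).
apply/funext => N; rewrite resE ipW_L_sq//.
by have [] := residual_L2 hd ha hab hc hbeta hgamma Lf hP N.
Qed.
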